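(* There exist cyclic cubic number fields $K$ of arbitrarily large discriminant whose unit signature rank is $1$, i.e. such that $\dim_{\mathbb{F}_2}\operatorname{sgn}_\infty(\mathcal{O}_K^\times)=1$.
   Context: For a totally real number field $K$ of degree $n$, the archimedean signature map $\operatorname{sgn}_\infty\colon K^\times\to\prod_{v\text{ real}}\{\pm1\}\simeq\mathbb{F}_2^n$ sends $\alpha$ to the tuple of signs $v(\alpha)/|v(\alpha)|$ over the real embeddings $v$ of $K$. The unit signature rank of $K$ is $\dim_{\mathbb{F}_2}\operatorname{sgn}_\infty(\mathcal{O}_K^\times)$, where $\mathcal{O}_K^\times$ is the unit group of the ring of integers. A cyclic cubic field is a Galois extension of $\mathbb{Q}$ of degree $3$. *)

(* Defs.v *)
From HB Require Import structures.
From mathcomp Require Import all_boot all_order all_algebra all_field.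
From mathcomp Require Import finmap.
From mathcomp Require Import boolp classical_sets cardinality reals.
Set Implicit Arguments.
Unset Strict Implicit.
Unset Printing Implicit Defensive.
Import Order.TTheory GRing.Theory Num.Theory.
Local Open Scope ring_scope.

Definition ring_of_integers (K : fieldExtType rat) (x : K) : Prop :=
  integralOver (intr : int -> K) x.

(* [x != 0] is needed because [0^-1 = 0]. *)
Definition integer_unit (K : fieldExtType rat) (x : K) : Prop :=
  [/\ x != 0, ring_of_integers x & ring_of_integers x^-1].

(* The trace of multiplication by [x], a Q-linear endomorphism of [K]. *)
Definition field_trace (K : fieldExtType rat) (x : K) : rat :=
  \sum_(i < \dim {:K}) coord (vbasis {:K}) i (x * (vbasis {:K})`_i).

Definition integral_basis (K : fieldExtType rat)
    (w : (\dim {:K}).-tuple K) : Prop :=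
  free w /\
  forall x : K, ring_of_integers x <->
    exists c : 'I_(\dim {:K}) -> int, x = \sum_(i < \dim {:K}) w`_i *~ c i.

Definition is_discriminant (K : fieldExtType rat) (d : int) : Prop :=
  exists w : (\dim {:K}).-tuple K, integral_basis w /\
    d%:~R = \det (\matrix_(i < \dim {:K}, j < \dim {:K}) field_trace (w`_i * w`_j)).

Definition cyclic_cubic (K : splittingFieldType rat) : Prop :=
  galois 1 {:K} /\ \dim {:K} = 3.

Lemma roots_in_seq (F : fieldType) (p : {poly F}) :
  p != 0 -> exists s : seq F, forall x, root p x -> x \in s.
Proof.
have [n] := ubnP (size p); elim: n p => // n IHn p lt_p_n nz_p.
have [[x /factor_theorem[q Dp]]|no_root] := pselect (exists x, root p x).
  have nz_q : q != 0 by apply: contraNneq nz_p => q0; rewrite Dp q0 mul0r.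
  have [|s sP] := IHn q _ nz_q.
    by move: lt_p_n; rewrite Dp size_Mmonic ?monicXsubC// size_XsubC addn2.
  exists (x :: s) => y; rewrite Dp rootM root_XsubC inE orbC.
  by case/orP=> [->//|/sP->]; rewrite orbT.
by exists [::] => x px; case: no_root; exists x.
Qed.

Section Signature.
Variables (R : realType) (K : fieldExtType rat).

(* Embeddings are identified when they agree as functions. *)
Definition is_real_embedding : set (K -> R) :=
  [set v : K -> R | exists f : {rmorphism K -> R}, v = f].

(* [fset_set] of an infinite set is [fset0]: this rules that case out. *)
Lemma finite_real_embedding : finite_set is_real_embedding.
Proof.
pose z := separable_generator 1 {:K}.
have defK : fullv = <<1; z>>%VS :> {vspace K}.
  apply: eq_adjoin_separable_generator (subvf _).
  apply/separableP=> y _; apply: pcharf0_separable => l.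
  by rewrite pchar_lalg pchar_num.
pose g (r : R) (x : K) : R :=
  let q := xget 0 [set q : {poly rat} | x = (map_poly (in_alg K) q).[z]] in
  (map_poly ratr q).[r].
have ratE (f : {rmorphism K -> R}) (q : {poly rat}) :
    f (map_poly (in_alg K) q).[z] = (map_poly ratr q).[f z].
  rewrite -horner_map -map_poly_comp; congr (_.[_]); apply: eq_map_poly => a.
  exact: (fmorph_eq_rat (f \o in_alg K)).
have /polyOver1P[p Dp] := minPolyOver 1 z.
have [|s s_roots] := roots_in_seq (p := map_poly (ratr : rat -> R) p) _.
  rewrite map_poly_eq0 -(map_poly_eq0 (in_alg K)) -Dp.
  by rewrite monic_neq0 ?monic_minPoly.
apply: (@sub_finite_set _ _ (g @` [set` s])).
  2: by apply: finite_image; exact: finite_seq.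
move=> _ [f ->]; exists (f z) => /=.
  by apply: s_roots; rewrite /root -ratE -Dp minPolyxx rmorph0.
apply/funext => x; rewrite /g; case: xgetP => [q _ ->|nox].
  by rewrite ratE.
have /Fadjoin_polyP[q /polyOver1P[q' ->] Dx] : x \in <<1; z>>%VS.
  by rewrite -defK memvf.
by case: (nox q').
Qed.

Definition real_embedding : {fset (K -> R)} := fset_set is_real_embedding.

(* [{1, -1}] is identified with [F_2] by [1 |-> 0] and [-1 |-> 1]; the value at
   [x = 0] is irrelevant. *)
Definition sgn_infty (x : K) : {ffun real_embedding -> ('F_2)^o} :=
  [ffun v => (val v x / `|val v x| == -1)%:R].

Definition unit_signatures : {set {ffun real_embedding -> ('F_2)^o}} :=
  [set s | `[< exists2 u : K, integer_unit u & s = sgn_infty u >]].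

Lemma sgn_inftyM x y : x != 0 -> y != 0 ->
  sgn_infty (x * y) = sgn_infty x + sgn_infty y.
Proof.
move=> nzx nzy; apply/ffunP => v; rewrite !ffunE.
have: fsval v \in is_real_embedding.
  by rewrite -(in_fset_set finite_real_embedding) fsvalP.
rewrite inE => -[f /= ->]; rewrite rmorphM normrM invfM mulrACA.
have sgE z : z != 0 -> f z / `|f z| = (-1) ^+ (f z < 0)%R.
  move=> nzz; have nzfz : f z != 0 by rewrite fmorph_eq0.
  by rewrite [X in X / _]numEsign -mulrA divff ?mulr1// normr_eq0.
rewrite !sgE //; case: (_ < 0)%R; case: (_ < 0)%R;
  rewrite ?expr0 ?expr1 ?mulrNN ?mulr1 ?mul1r ?eqxx ?eqNr ?oner_eq0;
  by rewrite ?[1 == -1]eq_sym ?eqNr ?oner_eq0 //; apply/val_inj.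
Qed.

(* The span in [unit_signature_rank] adds nothing to [unit_signatures]. *)
Lemma mem_span_unit_signatures s :
  (s \in <<enum unit_signatures>>%VS) = (s \in unit_signatures).
Proof.
apply/idP/idP => [|s_unit]; last by rewrite memv_span ?mem_enum.
have sig0 : 0 \in unit_signatures.
  rewrite inE; apply/asboolP; exists 1.
    by split; rewrite ?invr1 ?oner_eq0 //; exact: integral1.
  have := sgn_inftyM (oner_neq0 _) (oner_neq0 _); rewrite mulr1.
  by move/(congr1 (fun t => t - sgn_infty 1)); rewrite subrr addrK.
have sigD t1 t2 : t1 \in unit_signatures -> t2 \in unit_signatures ->
    t1 + t2 \in unit_signatures.
  rewrite !inE => -[u1 [nz1 i1 j1] ->] [u2 [nz2 i2 j2] ->].
  exists (u1 * u2); last by rewrite sgn_inftyM.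
  by split; rewrite ?mulf_neq0 ?invfM //; exact: integral_mul.
move/(@coord_span _ _ _ (in_tuple _)) => ->.
elim/big_ind: _ => // i _.
have: (in_tuple (enum unit_signatures))`_i \in unit_signatures.
  by rewrite -mem_enum mem_nth.
move: (coord _ _ _) => c sigi; rewrite -[c]natr_Zp scaler_nat.
by elim: (nat_of_ord c) => [|k IHk]; rewrite ?mulr0n // mulrS sigD.
Qed.

Definition unit_signature_rank : nat := \dim <<enum unit_signatures>>%VS.

End Signature.

(* Main.v *)
Require Import Defs.
From HB Require Import structures.
From mathcomp Require Import all_boot all_order all_algebra all_fingroup all_solvable all_field.
From mathcomp Require Import finmap zify ring lra.
From mathcomp Require Import boolp classical_sets cardinality reals sequences exp.
Set Implicit Arguments.
Unset Strict Implicit.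
Unset Printing Implicit Defensive.
Import Order.TTheory GRing.Theory Num.Theory.
Local Open Scope ring_scope.

(** The fields are K = Q(w), where w is a root of X^3 - 2mX^2 + 5mX - m and
    68m^2 - 320m - 27 is a square, so that K is cyclic.  All conjugates of w are
    positive and w^3 is m times a unit, so u = w / s(w) is a totally positive
    unit.  Starting from m = 37, the Pell unit 33 + 8 sqrt 17 gives infinitely
    many m close to 37 modulo any given integer.  Among three consecutive values
    one is not 37 times a cube, because the product of the outer two is too close
    to the square of the middle one; such an m has a large prime factor p with
    exponent prime to 3, and p ramifies in K.  The condition m = 37 mod 11
    prevents u from being a square.  Modulo -1 the units form a free
    Z[omega]-module of rank 1 generated by some e; if e had mixed signs, then a
    totally positive unit would be a square.  As u is not, all units have constant
    sign. *)

(** * An orbit of integral points on a conic *)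

(** Under the Galois group, units modulo squares are the class of -1 plus a simple piece of
    dimension 2 over F_2. The kernel of the signature map does not contain -1, so it is trivial or
    that whole piece: the rank is 3 or 1, and one totally positive nonsquare unit forces 1. In the
    cubic, every coefficient after the leading one is a multiple of the constant term [m], which is
    the norm of w; hence w^3 / m is integral of norm 1. The alternating signs exclude nonpositive
    roots. The leading coefficient 68 = 4 * 17 of the conic is positive and not a square, so one
    integral point yields infinitely many. A large [m] alone does not give a large discriminant, as
    Z[w] may have large index in the ring of integers; the lower bound has to come from a ramified
    prime. A prime whose exponent in [m] is a multiple of 3 can be scaled out of w, hence the detour
    through noncubes. The same exponent condition also excludes rational roots. *)

Definition pell_step (R : comNzRingType) (z : R * R) : R * R :=
  (33 * z.1 + 136 * z.2, 8 * z.1 + 33 * z.2).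

(** The step multiplies x + y sqrt 17 by 33 + 8 sqrt 17, of norm 1, so the conjugate 33 - 8 sqrt 17
    undoes it. It is defined over any ring in order to act on pairs modulo [W] as well. *)
Lemma pell_step_inj (R : comNzRingType) : injective (@pell_step R).
Proof.
apply: (can_inj (g := fun z => (33 * z.1 - 136 * z.2, 33 * z.2 - 8 * z.1))).
by move=> [x y]; rewrite /pell_step /=; congr pair; ring.
Qed.

Lemma pell_iterP n (z := iter n (@pell_step int) (1, 0)) :
  [/\ z.1 ^+ 2 = 17 * z.2 ^+ 2 + 1, 1 <= z.1 & n%:Z <= z.2].
Proof.
rewrite {}/z; elim: n => [|n] /=; first by split; rewrite ?lexx // expr0n expr1n mulr0.
case: (iter _ _ _) => x y /= [e x1 y0].
by rewrite !expr2 in e *; split; lia.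
Qed.

Lemma Zp_intr_eq0 (p : nat) (t : int) :
  (1 < p)%N -> (t%:~R == 0 :> 'Z_p) = (p%:Z %| t)%Z.
Proof.
move=> p1; have natP (n : nat) : (n%:R == 0 :> 'Z_p) = (p %| n)%N.
  by rewrite -val_eqE /= val_Zp_nat.
by case: t => n; rewrite ?NegzE ?rmorphN ?oppr_eq0 ?dvdzN -?pmulrn natP.
Qed.

(** An injective map of the finite set (Z/W)^2 is a permutation, so the orbit of (1, 0) is periodic.
    Iterating over the integers for one period gives a nontrivial solution congruent to the trivial
    one. *)
Lemma pell_mod (W : nat) : (1 < W)%N ->
  exists X Y : int, [/\ X ^+ 2 = 17 * Y ^+ 2 + 1, 1 <= X, 0 < Y,
     (W%:Z %| X - 1)%Z & (W%:Z %| Y)%Z].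
Proof.
move=> W1; pose f := @pell_step 'Z_W.
have fI : injective f by exact: pell_step_inj.
pose n := fingraph.order f (1, 0).
have n0 : (0 < n)%N by exact: fingraph.order_gt0.
have [] := pell_iterP n; set z := iter _ _ _ => zE z1 z2.
have [zf1 zf2] : (z.1%:~R, z.2%:~R) = (1, 0) :> 'Z_W * 'Z_W.
  rewrite -[RHS](iter_order fI) -/n /z; elim: (n) => //= k <-.
  by rewrite /f /pell_step /=; congr pair; rewrite rmorphD !rmorphM.
exists z.1, z.2; split=> //; first by lia.
  by rewrite -Zp_intr_eq0 // rmorphB /= zf1 subrr.
by rewrite -Zp_intr_eq0 // zf2.
Qed.

(* The discriminant of [X^3 - 2mX^2 + 5mX - m] is [m^2 (68m^2 - 320m - 27)]. *)
Definition on_conic (m y : int) := y ^+ 2 = 68 * m ^+ 2 - 320 * m - 27.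

(* Multiplication of [34m - 80 + y sqrt 17], of norm [19^3], by the norm 1 unit
   [1 + 68k + Y sqrt 68]. *)
Definition conic_shift (k Y : int) (P : int * int) : int * int :=
  (P.1 + (68 * P.1 - 160) * k + P.2 * Y,
   (68 * P.1 - 160) * Y + P.2 * (1 + 68 * k)).

Lemma conic_shiftP k Y P : Y ^+ 2 = k * (68 * k + 2) ->
  on_conic P.1 P.2 ->
  on_conic (conic_shift k Y P).1 (conic_shift k Y P).2.
Proof.
case: P => m y; rewrite /on_conic /= => kE yE; apply/eqP.
have -> : ((68 * m - 160) * Y + y * (1 + 68 * k)) ^+ 2 =
  (68 * m - 160) ^+ 2 * Y ^+ 2 + y ^+ 2 * (1 + 68 * k) ^+ 2
   + 2 * (68 * m - 160) * (1 + 68 * k) * (Y * y) by ring.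
have -> : (m + (68 * m - 160) * k + y * Y) ^+ 2 =
  (m + (68 * m - 160) * k) ^+ 2 + y ^+ 2 * Y ^+ 2
   + 2 * (m + (68 * m - 160) * k) * (Y * y) by ring.
by rewrite kE yE; apply/eqP; ring.
Qed.

(** For fixed [k], the product of the outer two of three consecutive terms differs from the square
    of the middle one only by an expression linear in that middle term. *)
Lemma conic_shift_mul k Y m y : Y ^+ 2 = k * (68 * k + 2) -> on_conic m y ->
  (conic_shift k Y (conic_shift k Y (m, y))).1 * m =
  (conic_shift k Y (m, y)).1 ^+ 2 + 320 * k * (conic_shift k Y (m, y)).1
  + 4 * 19 ^+ 3 * k ^+ 2 + 54 * k.
Proof.
rewrite /on_conic /= => kE yE; apply/eqP; rewrite -subr_eq0; apply/eqP.
transitivity (m * (68 * m - 160) * (Y ^+ 2 - k * (68 * k + 2))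
  - (y ^+ 2 - (68 * m ^+ 2 - 320 * m - 27)) * Y ^+ 2
  - (68 * m ^+ 2 - 320 * m - 27) * (Y ^+ 2 - k * (68 * k + 2))); last by rewrite kE yE; ring.
ring.
Qed.

Lemma PoszX (n k : nat) : (n ^ k)%N%:Z = n%:Z ^+ k.
Proof. by elim: k => // k IHk; rewrite expnS exprS PoszM IHk. Qed.

Lemma cube_of_logn (m : nat) : (0 < m)%N ->
  (forall p, prime p -> (3 %| logn p m)%N) -> exists h : nat, m = (h ^ 3)%N.
Proof.
move=> m0 cm; exists (\prod_(p <- primes m) p ^ (logn p m %/ 3))%N.
rewrite [LHS]prod_prime_decomp // prime_decompE big_map /=.
rewrite (big_morph (expn^~ 3) (fun x y => expnMn x y 3) (exp1n 3)).
rewrite big_seq [RHS]big_seq; apply: eq_bigr => p.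
by rewrite mem_primes => /and3P[/cm/divnK + _ _]; rewrite -expnM => ->.
Qed.

Lemma not_cube_between (t h : nat) :
  ((h ^ 2) ^ 3 < t ^ 3)%N -> (t ^ 3 < (h ^ 2 + 1) ^ 3)%N -> False.
Proof. by rewrite !ltn_exp2r // addn1 ltnS [(t <= _)%N]leqNgt => ht /negP[]. Qed.

(* By [conic_shift_mul], [(h0 h2)^3] lies strictly between [h1^6] and [(h1^2+1)^3]. *)
Lemma conic_shift_not_cube (k Y m y : int) (h0 h1 h2 : nat) :
  Y ^+ 2 = k * (68 * k + 2) -> on_conic m y -> 0 < k ->
  m = 37 * h0%:Z ^+ 3 ->
  (conic_shift k Y (m, y)).1 = 37 * h1%:Z ^+ 3 ->
  (conic_shift k Y (conic_shift k Y (m, y))).1 = 37 * h2%:Z ^+ 3 ->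
  60 * k <= h1%:Z -> False.
Proof.
move=> kE my k0 mE m1E m2E hk.
have := conic_shift_mul kE my; rewrite m1E m2E mE => e.
set h := h1%:Z in e hk.
have e' : 37 ^+ 2 * (h0 * h2)%:Z ^+ 3 =
    37 ^+ 2 * h ^+ 6 + 320 * 37 * (k * h ^+ 3) + 4 * 19 ^+ 3 * k ^+ 2 + 54 * k.
  rewrite PoszM exprMn; transitivity (37 * h2%:Z ^+ 3 * (37 * h0%:Z ^+ 3)); first by ring.
  by rewrite e; ring.
have h0' : 0 < h by apply: lt_le_trans hk; rewrite mulr_gt0.
have hkk : 0 < h ^+ 3 by rewrite exprn_gt0.
have i5 : 0 < k * h ^+ 3 by rewrite mulr_gt0.
have i6 : 0 < k ^+ 2 by rewrite exprn_gt0.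
apply: (@not_cube_between (h0 * h2) h1); rewrite -ltz_nat !PoszX ?PoszD ?PoszX -/h.
  rewrite -(ltr_pM2l (x := 37 ^+ 2)) // e' -exprM.
  by move: (h ^+ (2 * 3)) (k * h ^+ 3) (k ^+ 2) i5 i6 => *; lia.
rewrite -(ltr_pM2l (x := 37 ^+ 2)) // e'.
(* As [60 * k <= h], the error terms add up to at most [198 * h ^+ 4 + 8 * h ^+ 2], well below the
   available [37 ^+ 2 * (3 * h ^+ 4 + 3 * h ^+ 2 + 1)]. *)
have i1 : 60 * (k * h ^+ 3) <= h ^+ 4 by rewrite mulrA [h ^+ 4]exprS ler_wpM2r // ltW.
have i2 : 60 * 60 * k ^+ 2 <= h ^+ 2.
  have -> : 60 * 60 * k ^+ 2 = (60 * k) ^+ 2 by ring.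
  by rewrite ler_pXn2r // nnegrE ltW // mulr_gt0.
have i3 : h ^+ 2 <= h ^+ 4 by rewrite ler_weXn2l //; lia.
have i4 : k <= k ^+ 2 by rewrite -[X in X <= _]expr1 ler_weXn2l //; lia.
have -> : (h ^+ 2 + 1) ^+ 3 = h ^+ 6 + 3 * h ^+ 4 + 3 * h ^+ 2 + 1 by ring.
move: (k * h ^+ 3) (h ^+ 6) (h ^+ 4) (h ^+ 2) (k ^+ 2) i1 i2 i3 i4 i5 i6.
by move=> *; lia.
Qed.

Definition conic_seq k Y j := iter j (conic_shift k Y) (37, 285).

(** A step adds to [m] at least [(68 * m - 160) * k], which is at least [60 * k * m] once [m >= 20]:
    this gives the geometric growth. It adds only multiples of [k] and [Y], so the residue modulo
    [V] stays 37. *)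
Lemma conic_seqP (V k Y : int) j : Y ^+ 2 = k * (68 * k + 2) -> 0 < k -> 0 < Y ->
  (V %| k)%Z -> (V %| Y)%Z ->
  [/\ on_conic (conic_seq k Y j).1 (conic_seq k Y j).2,
      37 <= (conic_seq k Y j).1, 0 < (conic_seq k Y j).2,
      37 * (60 * k) ^+ j <= (conic_seq k Y j).1
    & (V %| (conic_seq k Y j).1 - 37)%Z].
Proof.
move=> kE k0 Y0 Vk VY; elim: j => [|j [c m1 y1 g d]]; first by rewrite /on_conic; split; rewrite /= ?subrr ?expr0.
rewrite /conic_seq iterS -/(conic_seq k Y j).
case: (conic_seq k Y j) c m1 y1 g d => m y /= c m1 y1 g d.
have c1 := conic_shiftP (P := (m, y)) kE c.
have dV : (V %| (m - 37) + (68 * m - 160) * k + y * Y)%Z.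
  by apply: rpredD; [apply: rpredD => //|]; exact: dvdz_mull.
have gm : 37 * (60 * k) ^+ j * (60 * k) <= m * (60 * k) by rewrite ler_pM2r // mulr_gt0.
rewrite exprSr mulrA; move: ((37 * (60 * k) ^+ j)) gm => G {g d kE c Vk VY} gm.
have yY : 0 < y * Y by rewrite mulr_gt0.
have mk : m * (60 * k) <= (68 * m - 160) * k by rewrite mulrA ler_pM2r //; lia.
have mY : 0 < (68 * m - 160) * Y by rewrite mulr_gt0 //; lia.
have yk : 0 < y * (1 + 68 * k) by rewrite mulr_gt0 // addr_gt0 // mulr_gt0.
have mk0 : 0 <= (68 * m - 160) * k by rewrite mulr_ge0 //; lia.
split=> //=.
- by move: mk0 yY; set a := _ * k; set b := _ * Y; clear -m1; lia.
- by rewrite addr_gt0.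
- by apply: le_trans (le_trans gm mk) _; move: yY; set a := _ * k; set b := _ * Y; clear -m1; lia.
by rewrite (_ : _ - 37 = m - 37 + (68 * m - 160) * k + y * Y) //; ring.
Qed.

Lemma exists_conic_point (N : nat) : exists (m : nat) (y : int) (p : nat),
  [/\ on_conic m y, (m = 4 %[mod 11])%N, prime p, (N < p)%N & ~~ (3 %| logn p m)%N].
Proof.
(* With [m] equal to 37 modulo [V], the quotient m / 37 is 1 modulo [37 * 11 * N!], so its prime
   factors exceed [N] and differ from 37. The second factor 37 in [V] survives the division by
   37. *)
pose V := (37 * 37 * 11 * N`!)%N.
have V0 : (0 < V)%N by rewrite !muln_gt0 fact_gt0.
(* The factor 68 in the modulus makes (X - 1) / 68 and Y / 2 integers divisible by [V]; the Pell
   unit then takes the form 1 + 68 k + Y' sqrt 68 expected by [conic_shift]. *)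
have [|X [Y [XY X1 Y0 /dvdzP[k1 kE] /dvdzP[y1 yE]]]] := @pell_mod (68 * V).
  by lia.
pose k := k1 * V%:Z; pose Y' := y1 * 34 * V%:Z.
have X_k : X = 1 + 68 * k by rewrite /k; move: kE; rewrite PoszM; lia.
have Y_Y : Y = 2 * Y' by rewrite /Y' yE PoszM; ring.
have eY : Y' ^+ 2 = k * (68 * k + 2).
  by move: XY; rewrite X_k Y_Y !expr2; move: k Y' {X_k Y_Y X1} => k Y'; lia.
have Y0' : 0 < Y' by lia.
have k0 : 0 < k.
  have : 0 <= k by lia.
  rewrite le_eqVlt => /orP[/eqP k00|//].
  by move: eY; rewrite -k00 mul0r => /eqP; rewrite sqrf_eq0 gt_eqF.
have seqP j := conic_seqP j eY k0 Y0' (dvdz_mull k1 (dvdzz _)) (dvdz_mull (y1 * 34) (dvdzz _)).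
have quoP j : exists q : nat, [/\ (conic_seq k Y' j).1 = (37 * q)%N%:Z, (0 < q)%N & coprime (37 * 11 * N`!) q].
  have [_ m1 _ _ /dvdzP[c cE]] := seqP j.
  have eq : (conic_seq k Y' j).1 = 37 * (1 + c * (37 * 11 * N`!)%N%:Z).
    by rewrite -[LHS](subrK 37) cE /V !PoszM; ring.
  have q0 : 0 < 1 + c * (37 * 11 * N`!)%N%:Z by lia.
  exists `|(1 + c * (37 * 11 * N`!)%N%:Z)%R|%N; split; [by rewrite PoszM gtz0_abs|by rewrite absz_gt0 gt_eqF|].
  rewrite -[(_ * _ * _)%N]/`|Posz _|%N -/(coprimez _ _).
  by apply/coprimezP; exists (- c, 1); rewrite /=; ring.
have [j [q [qE q0 cq nq]]] : exists (j q : nat), [/\ (conic_seq k Y' j).1 = (37 * q)%N%:Z, (0 < q)%N,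
    coprime (37 * 11 * N`!) q & ~ exists h : nat, q = (h ^ 3)%N].
  (* The triple starts at index 2 because its middle term, of index 3, is at least
     [37 * (60 * k) ^+ 3]; if it is [37 * h3 ^ 3], then [60 * k <= h3]. *)
  have [q2 [e2 p2 c2]] := quoP 2%N; have [q3 [e3 p3 c3]] := quoP 3%N.
  have [q4 [e4 p4 c4]] := quoP 4%N.
  have [[h2 hE2]|] := EM (exists h : nat, q2 = (h ^ 3)%N); last by exists 2%N, q2.
  have [[h3 hE3]|] := EM (exists h : nat, q3 = (h ^ 3)%N); last by exists 3%N, q3.
  have [[h4 hE4]|] := EM (exists h : nat, q4 = (h ^ 3)%N); last by exists 4%N, q4.
  exfalso; have [c _ _ _ _] := seqP 2%N.
  apply: (@conic_shift_not_cube k Y' (conic_seq k Y' 2).1 (conic_seq k Y' 2).2 h2 h3 h4) => //.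
  - by rewrite e2 hE2 PoszM PoszX.
  - by rewrite -surjective_pairing -iterS -/(conic_seq k Y' 3) e3 hE3 PoszM PoszX.
  - by rewrite -surjective_pairing -!iterS -/(conic_seq k Y' 4) e4 hE4 PoszM PoszX.
  have [_ _ _ + _] := seqP 3%N; rewrite e3 hE3 PoszM PoszX ler_pM2l //.
  by rewrite ler_pXn2r // nnegrE ?ltW // mulr_gt0.
have [p p_pr np] : exists2 p, prime p & ~~ (3 %| logn p q)%N.
  apply: contrapT => Hp; apply: nq; apply: cube_of_logn => // p p_pr.
  by apply: contrapT => /negP n3; apply: Hp; exists p.
have pq : (p %| q)%N.
  have : (0 < logn p q)%N by case: (logn p q) np.
  by rewrite logn_gt0 mem_primes => /and3P[].
have cp : coprime p (37 * 11 * N`!) by rewrite coprime_sym; apply: coprime_dvdr pq cq.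
have [c _ _ _ /dvdzP[d dE]] := seqP j; rewrite qE in c dE.
exists (37 * q)%N, (conic_seq k Y' j).2, p; split=> //.
- have : (37 * q)%N%:Z = 37 + 11 * (d * (37 * 37 * N`!)%N%:Z).
    by rewrite -[LHS](subrK 37) dE /V !PoszM; ring.
  by lia.
- rewrite ltnNge; apply/negP => pN.
  have : (p %| gcdn p (37 * 11 * N`!))%N.
    by rewrite dvdn_gcd dvdnn dvdn_mull // dvdn_fact // prime_gt0.
  by rewrite (eqP cp) dvdn1 => /eqP p1; rewrite p1 in p_pr.
rewrite lognM // (_ : logn p 37 = 0)%N // logn_prime //.
by case: eqP cp => // ->; rewrite -mulnA coprimeMr.
Qed.

(** * Integers and units of a cyclic cubic field *)

Section Integers.
Variable K : fieldExtType rat.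
Implicit Types x y : K.
Local Notation Oint := (@ring_of_integers K).

Lemma Oint_int (z : int) : Oint z%:~R. Proof. exact: integral_id. Qed.
Lemma OintD x y : Oint x -> Oint y -> Oint (x + y). Proof. exact: integral_add. Qed.
Lemma OintB x y : Oint x -> Oint y -> Oint (x - y). Proof. exact: integral_sub. Qed.
Lemma OintM x y : Oint x -> Oint y -> Oint (x * y). Proof. exact: integral_mul. Qed.
Lemma OintN x : Oint x -> Oint (- x). Proof. exact: integral_opp. Qed.
Lemma OintX x n : Oint x -> Oint (x ^+ n).
Proof.
move=> xO; elim: n => [|n IHn]; first by rewrite expr0; exact: (Oint_int 1).
by rewrite exprS; exact: OintM.
Qed.

Lemma OintMz x (z : int) : Oint x -> Oint (x *~ z).
Proof. by move=> xO; rewrite -mulrzr; exact: OintM xO (Oint_int z). Qed.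

Lemma Oint_sum (I : Type) (r : seq I) (F : I -> K) :
  (forall i, Oint (F i)) -> Oint (\sum_(i <- r) F i).
Proof. by move=> FO; apply: big_ind => //; [exact: (Oint_int 0) | exact: OintD]. Qed.

Lemma Oint_rmorph (s : {rmorphism K -> K}) x : Oint x -> Oint (s x).
Proof.
case=> p p_monic px; exists p => //.
have -> : map_poly intr p = map_poly s (map_poly intr p).
  by rewrite -map_poly_comp; apply: eq_map_poly => z /=; rewrite rmorph_int.
exact: rmorph_root.
Qed.

Lemma Oint_unexp x n : (0 < n)%N -> Oint (x ^+ n) -> Oint x.
Proof.
move=> n0 xO; apply: (@integral_root_monic _ _ _ _ ('X^n - (x ^+ n)%:P)).
- by rewrite monicXnsubC.
- by rewrite rootE !hornerE subrr.
apply/integral_poly => i; rewrite coefB coefXn coefC; apply: OintB.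
  exact: (Oint_int (i == n)).
by case: ifP => _ //; exact: (Oint_int 0).
Qed.

(** Z is integrally closed; this is transported from the algebraic integers of [algC]. *)
Lemma Oint_rat (q : rat) : Oint q%:A -> exists z : int, q = z%:~R.
Proof.
case=> p p_monic pq.
have pq' : root (map_poly (intr : int -> rat) p) q.
  rewrite -(fmorph_root (in_alg K)) -map_poly_comp; congr root: pq.
  by apply: eq_map_poly => z /=; rewrite -[LHS](rmorph_int (in_alg K)).
have: (ratr q : algC) \in Num.int.
  apply: Cint_rat_Aint; first exact: Crat_rat.
  apply: (@root_monic_Aint (map_poly ratr (map_poly (intr : int -> rat) p))).
  - by rewrite fmorph_root.
  - by rewrite map_monic monic_map.
  apply/polyOverP => i; rewrite coef_map coef_map /= ratr_int; exact: intr_int.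
move=> /intrP[z zE]; exists z; apply: (fmorph_inj (ratr : rat -> algC)).
by rewrite /= zE ratr_int.
Qed.

End Integers.

(** * Symmetric functions of the conjugates, for a generator [s] of the Galois group *)

Section CyclicCubic.
Variables (K : fieldExtType rat) (s : {rmorphism K -> K}).
Hypothesis s3 : forall x, s (s (s x)) = x.
Hypothesis s_fix : forall x, s x = x -> exists q : rat, x = q%:A.
Implicit Types x y : K.
Local Notation Oint := (@ring_of_integers K).
Local Notation Ounit := (@integer_unit K).

Definition ctrace x := x + s x + s (s x).
Definition csym2 x := x * s x + s x * s (s x) + s (s x) * x.
Definition cnorm x := x * s x * s (s x).

Lemma fixed_Oint x : s x = x -> Oint x -> exists z : int, x = z%:~R.
Proof.
move=> /s_fix[q ->] /Oint_rat[z ->]; exists z.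
exact: (rmorph_int (in_alg K)).
Qed.

Lemma ctrace_int x : Oint x -> exists z : int, ctrace x = z%:~R.
Proof.
move=> xO; apply: fixed_Oint; first by rewrite /ctrace !rmorphD /= s3; ring.
by do 2?apply: OintD => //; do ?apply: Oint_rmorph.
Qed.

Lemma csym2_int x : Oint x -> exists z : int, csym2 x = z%:~R.
Proof.
move=> xO; apply: fixed_Oint; first by rewrite /csym2 !rmorphD !rmorphM /= s3; ring.
by do 2?apply: OintD => //; apply: OintM; do ?apply: Oint_rmorph.
Qed.

Lemma cnorm_int x : Oint x -> exists z : int, cnorm x = z%:~R.
Proof.
move=> xO; apply: fixed_Oint; first by rewrite /cnorm !rmorphM /= s3; ring.
by do 2?apply: OintM => //; do ?apply: Oint_rmorph.
Qed.

Lemma ccharpoly x : x ^+ 3 - ctrace x * x ^+ 2 + csym2 x * x - cnorm x = 0.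
Proof. by rewrite /ctrace /csym2 /cnorm; ring. Qed.

Lemma cnormM x y : cnorm (x * y) = cnorm x * cnorm y.
Proof. by rewrite /cnorm !rmorphM; ring. Qed.

Lemma OunitM x y : Ounit x -> Ounit y -> Ounit (x * y).
Proof.
move=> [x0 xO xO'] [y0 yO yO']; split; rewrite ?mulf_neq0 ?invfM //; exact: OintM.
Qed.

Lemma OunitV x : Ounit x -> Ounit x^-1.
Proof. by move=> [x0 xO xO']; split; rewrite ?invr_eq0 ?invrK. Qed.

Lemma OunitX x n : Ounit x -> Ounit (x ^+ n).
Proof.
move=> [x0 xO xO']; split; rewrite ?expf_neq0 -?exprVn //; exact: OintX.
Qed.

Lemma OunitXz x (z : int) : Ounit x -> Ounit (x ^ z).
Proof.
by move=> xU; case: z => n; [|apply: OunitV]; exact: OunitX.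
Qed.

Lemma Ounit_rmorph x : Ounit x -> Ounit (s x).
Proof.
by move=> [x0 xO xO']; split; rewrite ?fmorph_eq0 -?fmorphV //; exact: Oint_rmorph.
Qed.

Lemma intr_inj_K : injective (intr : int -> K).
Proof.
move=> a b; rewrite -2!(rmorph_int (in_alg K)) => /fmorph_inj; exact: intr_inj.
Qed.

Lemma cnorm_unit x : Ounit x -> cnorm x = 1 \/ cnorm x = - 1.
Proof.
move=> [x0 xO xO'].
have [a aE] := cnorm_int xO; have [b bE] := cnorm_int xO'.
have ab : a * b = 1.
  apply: intr_inj_K; rewrite rmorphM /= -aE -bE -cnormM divff //.
  by rewrite /cnorm !rmorph1 !mulr1.
have /eqP := congr1 absz ab; rewrite abszM muln_eq1 => /andP[/eqP a1 _].
have [aE'|aE'] : a = 1 \/ a = - 1 by lia.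
  by left; rewrite aE aE'.
by right; rewrite aE aE' rmorphN.
Qed.

End CyclicCubic.

(** * Signs of units *)

Lemma seq_argmin (R : realDomainType) (T : eqType) (P : T -> Prop) (f : T -> R) (r : seq T) :
  (exists2 x, x \in r & P x) ->
  exists x, P x /\ forall y, y \in r -> P y -> f x <= f y.
Proof.
elim: r => [[x] //|a r IHr] [x xr Px].
have [|noP] := EM (exists2 x, x \in r & P x).
  move=> /IHr[b [Pb minb]].
  have [Pa|nPa] := EM (P a); last first.
    exists b; split=> // y; rewrite inE => /predU1P[-> /nPa//|]; exact: minb.
  have [fab|fba] := leP (f a) (f b).
    exists a; split=> // y; rewrite inE => /predU1P[-> //|yr Py].
    exact: le_trans fab (minb _ yr Py).
  exists b; split=> // y; rewrite inE => /predU1P[-> _|]; [exact: ltW | exact: minb].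
have nP y : y \in r -> ~ P y by move=> yr Py; apply: noP; exists y.
have xa : x = a by move: xr; rewrite inE => /predU1P[//|/nP].
exists a; split=> [|y]; first by rewrite -xa.
by rewrite inE => /predU1P[-> //|/nP].
Qed.

Lemma exists_int_near (R : realType) (t : R) : exists z : int, `|t - z%:~R| <= 2^-1.
Proof.
exists (Num.floor (t + 2^-1)); set z := Num.floor _.
have := floor_le_tmp (t + 2^-1); have := lt_succ_floor (t + 2^-1).
rewrite -/z intrD ler_norml => h1 h2; apply/andP; split; lra.
Qed.

(** Northcott finiteness: there are finitely many integral cubics with bounded coefficients, each
    with finitely many roots. It is what makes a shortest unit exist. *)
Lemma finite_bounded_cubic_roots (K : fieldExtType rat) (n : nat) : exists r : seq K,
  forall (x : K) (a b c : int), `|a| <= n%:Z -> `|b| <= n%:Z -> `|c| <= n%:Z ->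
  x ^+ 3 - a%:~R * x ^+ 2 + b%:~R * x - c%:~R = 0 -> x \in r.
Proof.
pose P (t : int * int * int) : {poly K} :=
  'X^3 - (t.1.1%:~R)%:P * 'X^2 + (t.1.2%:~R)%:P * 'X - (t.2%:~R)%:P.
have P0 t : P t != 0.
  apply/negP => /eqP /(congr1 (fun q : {poly K} => q`_3)).
  rewrite !(coefB, coefD, coefCM, coefXn, coefX, coefC) /= ?coef0.
  by move/eqP; rewrite !mulr0 !subr0 addr0 oner_eq0.
pose rs t := sval (cid (roots_in_seq (P0 t))).
have rsP t x : root (P t) x -> x \in rs t by exact: svalP (cid (roots_in_seq (P0 t))) x.
pose I : seq int := [seq k%:Z - n%:Z | k <- iota 0 (2 * n).+1].
have inI (a : int) : `|a| <= n%:Z -> a \in I.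
  move=> an; apply/mapP; exists `|(a + n%:Z)%R|%N; last by lia.
  by rewrite mem_iota; lia.
exists (flatten [seq rs t | t <- [seq (ab, c) | ab <- [seq (a, b) | a <- I, b <- I], c <- I]]).
move=> x a b c an bn cn xE; apply/flattenP; exists (rs (a, b, c)).
  by apply: map_f; apply: allpairs_f; [apply: allpairs_f|]; exact: inI.
by apply: rsP; apply/eqP; rewrite -[RHS]xE /P !hornerE /=; ring.
Qed.

Lemma exprz_mod_square (F : fieldType) (t : F) (z : int) :
  t != 0 -> exists (c : F) (j : bool), t ^ z = c ^+ 2 * t ^+ j.
Proof.
move=> t0; have natP n : t ^+ n = (t ^+ n./2) ^+ 2 * t ^+ odd n.
  by rewrite -exprM -exprD muln2 addnC odd_double_half.
case: z => n; first by exists (t ^+ n./2), (odd n); rewrite -exprnP -natP.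
exists (t ^- n.+1 * t ^+ n.+1./2), (odd n.+1).
rewrite NegzE -exprnN exprMn -mulrA -natP expr2 -mulrA mulVf ?mulr1 //.
exact: expf_neq0.
Qed.

Section UnitSigns.
Variables (R : realType) (K : fieldExtType rat) (s : {rmorphism K -> K}).
Variable (v : {rmorphism K -> R}).
Hypothesis s3 : forall x, s (s (s x)) = x.
Hypothesis s_fix : forall x, s x = x -> exists q : rat, x = q%:A.
Implicit Types x y : K.
Local Notation Ounit := (@integer_unit K).

(** One embedding suffices: the logarithms at the other two places are the values of [lnv] at [s x]
    and [s (s x)]. *)
Let lnv x : R := ln `|v x|.

Lemma norm_emb_gt0 x : x != 0 -> 0 < `|v x|.
Proof. by move=> x0; rewrite normr_gt0 fmorph_eq0. Qed.

Lemma lnvM x y : x != 0 -> y != 0 -> lnv (x * y) = lnv x + lnv y.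
Proof. by move=> x0 y0; rewrite /lnv rmorphM normrM lnM ?posrE ?norm_emb_gt0. Qed.

Lemma lnvV x : x != 0 -> lnv x^-1 = - lnv x.
Proof. by move=> x0; rewrite /lnv fmorphV normfV lnV ?posrE ?norm_emb_gt0. Qed.

Lemma lnvX x n : x != 0 -> lnv (x ^+ n) = lnv x *+ n.
Proof. by move=> x0; rewrite /lnv rmorphXn normrX lnXn ?norm_emb_gt0. Qed.

Lemma lnvXz x (z : int) : x != 0 -> lnv (x ^ z) = z%:~R * lnv x.
Proof.
move=> x0; case: z => n; first by rewrite -exprnP lnvX // -pmulrn mulr_natl.
rewrite NegzE -exprnN lnvV ?expf_neq0 // lnvX // mulrNz -pmulrn mulNr.
by rewrite mulr_natl.
Qed.

Lemma lnv_sum x : Ounit x -> lnv (s (s x)) = - lnv x - lnv (s x).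
Proof.
move=> xU; have [x0 _ _] := xU.
have : lnv (cnorm s x) = 0.
  rewrite /lnv; have [->|->] := cnorm_unit s3 s_fix xU;
  by rewrite ?rmorphN rmorph1 ?normrN normr1 ln1.
by rewrite /cnorm !lnvM ?mulf_neq0 ?fmorph_eq0 // => e; lra.
Qed.

(* Half the squared length of the log vector [(l, l', -l-l')]; [s] rotates this
   vector by a third of a turn in the plane of sum zero. *)
Let lnform x : R := lnv x ^+ 2 + lnv x * lnv (s x) + lnv (s x) ^+ 2.

Lemma lnform_ge0 x : 0 <= lnform x. Proof. rewrite /lnform; nra. Qed.

Lemma lnform_eq0 x : Ounit x -> lnform x = 0 -> x = 1 \/ x = - 1.
Proof.
move=> [x0 _ _] Hx; have lnx0 : lnv x = 0.
  by apply/eqP; rewrite -sqrf_eq0; apply/eqP; move: Hx; rewrite /lnform; nra.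
have : `|v x| == 1 by rewrite -ln_eq0 ?norm_emb_gt0 // -/(lnv x) lnx0.
rewrite eqr_norml ler01 andbT => /orP[] /eqP vx; [left | right];
  by apply: (fmorph_inj v); rewrite vx ?rmorphN rmorph1.
Qed.

(** The hypothesis is available because [lnform] is at least half the square of each of the three
    logarithms. The bound then follows from 2 l <= l^2 + 1. *)
Lemma lnv_bound x (B : R) : x != 0 -> lnv x ^+ 2 <= 2 * B -> `|v x| <= expR (B + 1).
Proof.
move=> x0 lB; rewrite -[X in X <= _]lnK ?posrE ?norm_emb_gt0 // ler_expR -/(lnv x); nra.
Qed.

(** A bounded log vector bounds all conjugates by some [E], hence the trace by 3 E, the second
    symmetric function by 3 E^2 and the norm by E^3; [n] exceeds the sum of the three. *)
Lemma finite_lnform (B : R) : exists r : seq K, forall x, Ounit x -> lnform x <= B -> x \in r.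
Proof.
pose E := expR (B + 1); have E0 : 0 < E by exact: expR_gt0.
pose n := Num.bound (3 * E + 3 * E ^+ 2 + E ^+ 3).
have [r rP] := finite_bounded_cubic_roots K n.
exists r => x xU HB; have [x0 xO _] := xU.
have sx0 : s x != 0 by rewrite fmorph_eq0.
have ssx0 : s (s x) != 0 by rewrite !fmorph_eq0.
have b0 : `|v x| <= E by apply: lnv_bound => //; move: HB; rewrite /lnform; nra.
have b1 : `|v (s x)| <= E by apply: lnv_bound => //; move: HB; rewrite /lnform; nra.
have b2 : `|v (s (s x))| <= E.
  by apply: lnv_bound => //; move: HB; rewrite /lnform lnv_sum //; nra.
have E2 : 0 <= E ^+ 2 by rewrite exprn_ge0 // ltW.
have E3 : 0 <= E ^+ 3 by rewrite exprn_ge0 // ltW.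
have nE : 3 * E + 3 * E ^+ 2 + E ^+ 3 <= n%:R.
  by apply: ltW; apply: archi_boundP; rewrite !addr_ge0 // mulr_ge0 // ltW.
have bnd (z : int) y : y = z%:~R -> `|v y| <= 3 * E + 3 * E ^+ 2 + E ^+ 3 -> `|z| <= n%:Z.
  move=> -> h; rewrite -(ler_int R) intr_norm.
  by apply: le_trans nE; rewrite rmorph_int in h.
have [a aE] := ctrace_int s3 s_fix xO.
have [b bE] := csym2_int s3 s_fix xO.
have [c cE] := cnorm_int s3 s_fix xO.
have m2 (p q : R) : `|p| <= E -> `|q| <= E -> `|p * q| <= E ^+ 2.
  by move=> pE qE; rewrite normrM expr2 ler_pM.
have m3 (p q t : R) : `|p| <= E -> `|q| <= E -> `|t| <= E -> `|p * q * t| <= E ^+ 3.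
  by move=> pE qE tE; rewrite normrM exprSr ler_pM // m2.
apply: (rP x a b c).
- apply: (bnd _ _ aE); rewrite /ctrace !rmorphD.
  by apply: le_trans (ler_normD _ _) _; have := ler_normD (v x) (v (s x)); lra.
- apply: (bnd _ _ bE); rewrite /csym2 !rmorphD !rmorphM.
  have := m2 _ _ b0 b1; have := m2 _ _ b1 b2; have := m2 _ _ b2 b0.
  set p := _ * _; set q := _ * _; set t := _ * _ => h1 h2 h3.
  by apply: le_trans (ler_normD _ _) _; have := ler_normD t q; lra.
- by apply: (bnd _ _ cE); rewrite /cnorm !rmorphM; have := m3 _ _ _ b0 b1 b2; lra.
by rewrite -aE -bE -cE; exact: ccharpoly.
Qed.

(* The units modulo [-1] are a lattice stable under a rotation of order 3; since
   Z[omega] is Euclidean, a shortest unit [e] generates them together with [s e]. *)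
Lemma unit_mod_squares u : Ounit u -> u != 1 -> u != - 1 -> exists e,
  Ounit e /\ forall x, Ounit x -> exists (i j k : bool) (q : K),
    x = (-1) ^+ i * q ^+ 2 * e ^+ j * s e ^+ k.
Proof.
move=> uU u1 u1'.
have Hu : 0 < lnform u.
  rewrite lt_neqAle lnform_ge0 andbT; apply/eqP => /esym /(lnform_eq0 uU)[] /eqP; exact/negP.
have [r rP] := finite_lnform (lnform u).
have [|e [[eU He] emin]] := @seq_argmin _ _ (fun x => Ounit x /\ 0 < lnform x) lnform r.
  by exists u => //; apply: rP.
have {}emin x : Ounit x -> 0 < lnform x -> lnform e <= lnform x.
  move=> xU Hx; have [/rP xr|ltHx] := leP (lnform x) (lnform u); first by apply: emin => //; apply: xr.
  by apply: le_trans (ltW ltHx); apply: emin => //; apply: rP.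
exists e; split=> // x xU.
have [e0 _ _] := eU; have [x0 _ _] := xU.
have se0 : s e != 0 by rewrite fmorph_eq0.
set p := lnv e; set q := lnv (s e).
pose D := lnform e.
(* Cramer's rule for the coordinates of the log vector of [x] on those of [e] and [s e]; up to sign
   the determinant is [lnform e]. *)
pose a := (lnv x * (p + q) + lnv (s x) * q) / D.
pose b := (lnv x * q - lnv (s x) * p) / D.
have D0 : D != 0 by rewrite gt_eqF.
have lnx0 : lnv x = a * p + b * q by rewrite /a /b /D /lnform -/p -/q; field; rewrite -/p -/q in D0 *.
have lnx1 : lnv (s x) = a * q + b * (- p - q).
  by rewrite /a /b /D /lnform -/p -/q; field; rewrite -/p -/q in D0 *.
have [za ha] := exists_int_near a; have [zb hb] := exists_int_near b.
pose g := e ^ za * s e ^ zb.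
have gU : Ounit g by apply: OunitM; apply: OunitXz => //; exact: Ounit_rmorph.
have [g0 _ _] := gU.
have eza : e ^ za != 0 by rewrite expfz_neq0.
have ezb : s e ^ zb != 0 by rewrite expfz_neq0.
have lg0 : lnv g = za%:~R * p + zb%:~R * q by rewrite lnvM // !lnvXz.
have lg1 : lnv (s g) = za%:~R * q + zb%:~R * (- p - q).
  by rewrite rmorphM !fmorphXz lnvM ?fmorphXz ?expfz_neq0 ?fmorph_eq0 // !lnvXz ?fmorph_eq0 // -lnv_sum.
have y0 : x / g != 0 by rewrite mulf_neq0 ?invr_eq0.
have yU : Ounit (x / g) by apply: OunitM => //; exact: OunitV.
have Hy : lnform (x / g) = ((a - za%:~R) ^+ 2 - (a - za%:~R) * (b - zb%:~R) + (b - zb%:~R) ^+ 2) * D.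
  rewrite /lnform rmorphM fmorphV !lnvM ?invr_eq0 ?fmorph_eq0 // !lnvV ?fmorph_eq0 // lg0 lg1 lnx0 lnx1.
  by rewrite /D /lnform -/p -/q; ring.
(* The norm form A^2 - A B + B^2 of Z[omega] is at most 3/4 when |A| and |B| are at most 1/2, so a
   positive [lnform (x / g)] would be smaller than the minimum [lnform e]. *)
have Hy0 : lnform (x / g) = 0.
  have: ~ 0 < lnform (x / g).
    move=> /(emin _ yU); apply/negP; rewrite -ltNge Hy -/D -[ltRHS]mul1r ltr_pM2r //.
    move: ha hb; rewrite !ler_norml; move: (a - _) (b - _) => A B /andP[? ?] /andP[? ?]; nra.
  by move/negP; rewrite -leNgt => h; apply/eqP; rewrite eq_le h lnform_ge0.
have [i xE] : exists i : bool, x = (-1) ^+ i * g.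
  have [E|E] := lnform_eq0 yU Hy0; [exists false | exists true];
  by rewrite -[LHS](divfK g0) E ?expr0 ?expr1.
have [c [j jE]] := exprz_mod_square za e0.
have [d [k kE]] := exprz_mod_square zb se0.
by exists i, j, k, (c * d); rewrite xE /g jE kE; ring.
Qed.

Lemma neg_prod x y : x != 0 -> y != 0 -> (v (x * y) < 0) = (v x < 0) (+) (v y < 0).
Proof.
move=> x0 y0; have vx : v x != 0 by rewrite fmorph_eq0.
have vy : v y != 0 by rewrite fmorph_eq0.
rewrite rmorphM; case: (ltgtP (v x)) vx => // hx _; first by rewrite nmulr_rlt0 //=; case: ltgtP vy.
by rewrite pmulr_rlt0.
Qed.

Lemma neg_mod_square (i j k : bool) q e f : q != 0 -> e != 0 -> f != 0 ->
  (v ((-1) ^+ i * q ^+ 2 * e ^+ j * f ^+ k) < 0) =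
  i (+) (j && (v e < 0)) (+) (k && (v f < 0)).
Proof.
move=> q0 e0 f0.
have i0 : (-1) ^+ i != 0 :> K by rewrite expf_neq0 // oppr_eq0 oner_eq0.
have q2 : q ^+ 2 != 0 by rewrite expf_neq0.
have ej : e ^+ j != 0 by rewrite expf_neq0.
have fk : f ^+ k != 0 by rewrite expf_neq0.
have iq : (-1) ^+ i * q ^+ 2 != 0 by rewrite mulf_neq0.
have ie : (-1) ^+ i * q ^+ 2 * e ^+ j != 0 by rewrite mulf_neq0.
rewrite neg_prod // neg_prod // neg_prod //.
have -> : (v ((-1) ^+ i) < 0) = i.
  by case: (i); rewrite ?expr1 ?rmorphN rmorph1 ?oppr_lt0 ?ltr01 ?ltr10.
have -> : (v (q ^+ 2) < 0) = false by rewrite rmorphXn ltNge sqr_ge0.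
have bitP (b : bool) y : (v (y ^+ b) < 0) = b && (v y < 0).
  by case: b; rewrite //= expr0 rmorph1 ltr10.
by rewrite !bitP addbF.
Qed.

(** If the signs of [e], [s e], [s (s e)] were not all equal, the signatures of -1, [e] and [s e]
    would be linearly independent over F_2. Then [u], having trivial signature, would have exponents
    i = j = k = 0 and be a square. The final case analysis checks this on Booleans. *)
Lemma unit_signs_eq u : Ounit u -> 0 < v u -> 0 < v (s u) -> 0 < v (s (s u)) ->
  (forall q, u <> q ^+ 2) -> forall x, Ounit x ->
  (v (s x) < 0) = (v x < 0) /\ (v (s (s x)) < 0) = (v x < 0).
Proof.
move=> uU u0 u1 u2 usq x xU.
have [||e [eU eP]] := unit_mod_squares uU.
- by apply/eqP => uE; apply: (usq 1); rewrite expr1n.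
- by apply/negP => /eqP uE; move: u0; rewrite uE rmorphN rmorph1 oppr_gt0 ltr10.
have signP y : Ounit y -> exists (i j k : bool) (q : K),
   [/\ y = (-1) ^+ i * q ^+ 2 * e ^+ j * s e ^+ k,
    (v y < 0) = i (+) (j && (v e < 0)) (+) (k && (v (s e) < 0)),
    (v (s y) < 0) = i (+) (j && (v (s e) < 0)) (+) (k && (v (s (s e)) < 0))
   & (v (s (s y)) < 0) = i (+) (j && (v (s (s e)) < 0)) (+) (k && (v e < 0))].
  move=> yU; have [i [j [k [q yE]]]] := eP y yU; exists i, j, k, q.
  have [e0 _ _] := eU; have [y0 _ _] := yU.
  have q0 : q != 0.
    by apply: contraNneq y0 => q0; rewrite yE q0 expr0n mulr0 !mul0r.
  have sE : s y = (-1) ^+ i * s q ^+ 2 * s e ^+ j * s (s e) ^+ k.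
    by rewrite yE !rmorphM !rmorphXn rmorphN rmorph1.
  have ssE : s (s y) = (-1) ^+ i * s (s q) ^+ 2 * s (s e) ^+ j * e ^+ k.
    by rewrite sE !rmorphM !rmorphXn rmorphN rmorph1 s3.
  by split=> //; rewrite ?ssE ?sE ?[in LHS]yE neg_mod_square ?fmorph_eq0.
have [i [j [k [q [uE]]]]] := signP u uU.
rewrite (lt_gtF u0) (lt_gtF u1) (lt_gtF u2) => n0 n1 n2.
have [i' [j' [k' [q' [_ -> -> ->]]]]] := signP x xU.
have nsq : i || j || k.
  apply/negPn/negP => /norP[/norP[/negbTE i0 /negbTE j0] /negbTE k0].
  by apply: (usq q); rewrite uE i0 j0 k0 !expr0 mul1r !mulr1.
move: n0 n1 n2; case: (v e < 0); case: (v (s e) < 0); case: (v (s (s e)) < 0);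
  by move: nsq; case: (i); case: (j); case: (k); case: i'; case: j'; case: k'.
Qed.

Lemma fixed_emb (f : {rmorphism K -> R}) x : s x = x -> f x = v x.
Proof.
move=> /s_fix[q ->]; transitivity (ratr q : R).
  exact: (fmorph_eq_rat (f \o in_alg K)).
by symmetry; exact: (fmorph_eq_rat (v \o in_alg K)).
Qed.

(** [f x] is a root of the characteristic polynomial of [x], whose coefficients are rational, hence
    the same under [f] and [v], and alternate in sign: no root is nonpositive. This avoids
    classifying the embeddings of [K]. *)
Lemma emb_gt0 (f : {rmorphism K -> R}) x :
  0 < v x -> 0 < v (s x) -> 0 < v (s (s x)) -> 0 < f x.
Proof.
move=> x0 x1 x2.
have E : f x ^+ 3 - v (ctrace s x) * f x ^+ 2 + v (csym2 s x) * f x - v (cnorm s x) = 0.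
  have := congr1 f (ccharpoly s x).
  have -> : v (ctrace s x) = f (ctrace s x).
    by rewrite (fixed_emb f) // /ctrace !rmorphD /= s3; ring.
  have -> : v (csym2 s x) = f (csym2 s x).
    by rewrite (fixed_emb f) // /csym2 !rmorphD !rmorphM /= s3; ring.
  have -> : v (cnorm s x) = f (cnorm s x).
    by rewrite (fixed_emb f) // /cnorm !rmorphM /= s3; ring.
  move: (ctrace s x) (csym2 s x) (cnorm s x) => T S N.
  by rewrite rmorph0 !(rmorphB, rmorphD, rmorphM, rmorphXn).
have T0 : 0 < v (ctrace s x) by rewrite /ctrace !rmorphD !addr_gt0.
have S0 : 0 < v (csym2 s x) by rewrite /csym2 !rmorphD !rmorphM !addr_gt0 ?mulr_gt0.
have N0 : 0 < v (cnorm s x) by rewrite /cnorm !rmorphM !mulr_gt0.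
rewrite ltNge; apply/negP => fx; move: E.
have : f x ^+ 3 <= 0 by rewrite exprSr mulr_ge0_le0 // sqr_ge0.
have : 0 <= v (ctrace s x) * f x ^+ 2 by rewrite mulr_ge0 ?sqr_ge0 // ltW.
have : v (csym2 s x) * f x <= 0 by rewrite mulr_ge0_le0 // ltW.
lra.
Qed.

Lemma unit_emb_sign u : Ounit u -> 0 < v u -> 0 < v (s u) -> 0 < v (s (s u)) ->
  (forall q, u <> q ^+ 2) -> forall x (f : {rmorphism K -> R}), Ounit x ->
  (f x < 0) = (v x < 0).
Proof.
move=> uU u0 u1 u2 usq x f xU; have [n1 n2] := unit_signs_eq uU u0 u1 u2 usq xU.
have [x0 _ _] := xU.
have nz y : y != 0 -> (0 < v y) = ~~ (v y < 0).
  by move=> y0; have : v y != 0 by [rewrite fmorph_eq0]; case: ltgtP.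
have [vx|vx] := boolP (v x < 0).
  rewrite -oppr_gt0 -rmorphN emb_gt0 //; rewrite ?rmorphN oppr_gt0 //;
  by rewrite ?n1 ?n2.
by apply/negbTE; rewrite -leNgt ltW // emb_gt0 // nz ?fmorph_eq0 ?n1 ?n2.
Qed.

End UnitSigns.

(** The only unit signatures are 0 and the all-ones vector [c], attained at -1; [c] is nonzero
    because [v] itself is an index. *)
Lemma unit_signature_rank1 (R : realType) (K : fieldExtType rat) (v : {rmorphism K -> R}) :
  (forall x (f : {rmorphism K -> R}), integer_unit x -> (f x < 0) = (v x < 0)) ->
  unit_signature_rank R K = 1%N.
Proof.
move=> same.
pose c : {ffun real_embedding R K -> ('F_2)^o} := [ffun _ => 1].
have sgnE x : integer_unit x -> sgn_infty R x = if v x < 0 then c else 0.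
  move=> xU; have [x0 _ _] := xU; apply/ffunP => w; rewrite ffunE.
  have: fsval w \in @is_real_embedding R K.
    by rewrite -(in_fset_set (finite_real_embedding R K)) fsvalP.
  rewrite inE => -[f /= ->]; have fx0 : f x != 0 by rewrite fmorph_eq0.
  rewrite [X in X / _]numEsign -mulrA divff ?normr_eq0 // mulr1 (same x f xU).
  case: (v x < 0); rewrite !ffunE ?expr1 ?expr0 ?eqxx //.
  by rewrite eq_sym eqNr oner_eq0.
have vin : (v : K -> R) \in real_embedding R K.
  by rewrite in_fset_set ?inE; [exists v | exact: finite_real_embedding].
have c0 : c != 0.
  apply/eqP => /ffunP/(_ [` vin]%fset); rewrite !ffunE => /eqP.
  by rewrite oner_eq0.
have -> : unit_signature_rank R K = \dim <[c]>%VS; last by rewrite dim_vline c0.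
congr (\dim _); apply/eqP; rewrite eqEsubv; apply/andP; split.
  apply/span_subvP => t; rewrite mem_enum inE => /asboolP[x xU ->].
  by rewrite sgnE //; case: ifP => _; rewrite ?mem0v ?memv_line.
rewrite -memvE memv_span // mem_enum inE; apply/asboolP; exists (-1).
  by split; rewrite ?oppr_eq0 ?oner_eq0 ?invrN ?invr1 //; apply: integral_opp; exact: integral1.
rewrite sgnE ?rmorphN ?rmorph1 ?oppr_lt0 ?ltr01 //.
by split; rewrite ?oppr_eq0 ?oner_eq0 ?invrN ?invr1 //; apply: integral_opp; exact: integral1.
Qed.

(** * Integral bases and ramified primes *)

Section Discriminant.
Variables (K : fieldExtType rat) (s : {rmorphism K -> K}).
Hypothesis s3 : forall x, s (s (s x)) = x.
Hypothesis s_fix : forall x, s x = x -> exists q : rat, x = q%:A.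
Hypothesis dimK : \dim {:K} = 3.
Implicit Types x y : K.
Local Notation Oint := (@ring_of_integers K).
Local Notation n := (\dim {:K}).

Lemma rmorph_rat (f : {rmorphism K -> K}) (q : rat) : f q%:A = q%:A.
Proof.
transitivity (ratr q : K); first exact: (fmorph_eq_rat (f \o in_alg K)).
by symmetry; exact: (fmorph_eq_rat (in_alg K)).
Qed.

Lemma iter_rmorph k : exists f : {rmorphism K -> K}, forall x, f x = iter k s x.
Proof.
elim: k => [|k [f fE]]; first by exists idfun.
by exists (s \o f) => x /=; rewrite fE.
Qed.

Lemma iterM k x y : iter k s (x * y) = iter k s x * iter k s y.
Proof. by have [f fE] := iter_rmorph k; rewrite -!fE rmorphM. Qed.

Lemma iter_comb k (m : nat) (q : 'I_m -> rat) (b : 'I_m -> K) :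
  iter k s (\sum_i q i *: b i) = \sum_i (q i)%:A * iter k s (b i).
Proof.
have [f fE] := iter_rmorph k; rewrite -fE rmorph_sum; apply: eq_bigr => i _.
by rewrite -[q i *: b i]mulr_algl rmorphM /= rmorph_rat -fE.
Qed.

Lemma sum_iter x : \sum_(k < n) iter k s x = ctrace s x.
Proof. by rewrite dimK !big_ord_recl big_ord0 /= addr0 addrA. Qed.

Lemma ctrace_comb (m : nat) (c : 'I_m -> int) (b : 'I_m -> K) :
  ctrace s (\sum_i b i *~ c i) = \sum_i ctrace s (b i) *~ c i.
Proof.
rewrite /ctrace !rmorph_sum -!big_split; apply: eq_bigr => i _ /=.
by rewrite !rmorphMz !mulrzDl.
Qed.

Lemma exists_moved : exists x, s x <> x.
Proof.
apply: contrapT => no; have sid x : s x = x by apply: contrapT => h; apply: no; exists x.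
have : ({:K} <= 1)%VS.
  by apply/subvP => x _; have [q ->] := s_fix (sid x); rewrite rpredZ ?memv_line ?mem1v.
by move=> /dimvS; rewrite dimK dimv1.
Qed.

(** Vandermonde for the three conjugates of [w]: each coefficient is isolated by the quadratic that
    vanishes at the other two conjugates. The size is a variable [m] because [\dim {:K}] equals 3
    only propositionally. *)
Lemma power_conj_independent m (c : 'I_m -> K) w : m = 3%N -> s w <> w ->
  (forall i : 'I_m, \sum_(k < m) c k * iter k s (w ^+ i) = 0) -> forall k, c k = 0.
Proof.
move=> m3; subst m => ws.
have n01 : w - s w != 0 by rewrite subr_eq0; apply/eqP => /esym.
have n12 : s w - s (s w) != 0 by rewrite -rmorphB fmorph_eq0.
have n02 : w - s (s w) != 0.
  by rewrite -oppr_eq0 opprB -[X in _ - X]s3 -!rmorphB !fmorph_eq0.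
move=> cE; have := cE ord0; have := cE (lift ord0 ord0); have := cE ord_max.
rewrite !big_ord_recl !big_ord0 /= expr0 !rmorph1 !rmorphXn !addr0 !mulr1.
set c0 := c _; set c1 := c _; set c2 := c _ => e2 e1 e0.
have z0 : c0 = 0.
  apply/eqP; have : c0 * ((w - s w) * (w - s (s w))) == 0.
    apply/eqP; transitivity ((c0 * w ^+ 2 + (c1 * s w ^+ 2 + c2 * s (s w) ^+ 2))
      - (s w + s (s w)) * (c0 * w + (c1 * s w + c2 * s (s w)))
      + s w * s (s w) * (c0 + (c1 + c2))); first by ring.
    by rewrite e2 e1 e0; ring.
  by rewrite !mulf_eq0 (negbTE n01) (negbTE n02) !orbF.
have z1 : c1 = 0.
  apply/eqP; have : c1 * ((w - s w) * (s w - s (s w))) == 0.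
    apply/eqP; transitivity (- ((c0 * w ^+ 2 + (c1 * s w ^+ 2 + c2 * s (s w) ^+ 2))
      - (w + s (s w)) * (c0 * w + (c1 * s w + c2 * s (s w)))
      + w * s (s w) * (c0 + (c1 + c2)))); first by ring.
    by rewrite e2 e1 e0; ring.
  by rewrite !mulf_eq0 (negbTE n01) (negbTE n12) !orbF.
have z2 : c2 = 0 by move: e0; rewrite z0 z1 !add0r.
move=> k; case: k => -[|[|[|//]]] lt.
- by rewrite -[RHS]z0; congr c; apply: val_inj.
- by rewrite -[RHS]z1; congr c; apply: val_inj.
- by rewrite -[RHS]z2; congr c; apply: val_inj.
Qed.

Definition conj_mx (b : seq K) : 'M[K]_n := \matrix_(i, j) iter j s b`_i.

Lemma conj_mx_gram b : conj_mx b *m (conj_mx b)^T =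
  \matrix_(i, j) ctrace s (b`_i * b`_j).
Proof.
apply/matrixP => i j; rewrite !mxE -sum_iter; apply: eq_bigr => k _.
by rewrite !mxE iterM.
Qed.

Lemma conj_mx_basis (b : n.-tuple K) : (forall x, exists q : 'I_n -> rat, x = \sum_i q i *: b`_i) ->
  \det (conj_mx b) != 0.
Proof.
move=> bP; rewrite -det_tr; apply/negP => /det0P[c c0 cP].
move/negP: c0; apply; apply/eqP/rowP => k; rewrite mxE.
have [w sw] := exists_moved.
apply: (power_conj_independent dimK sw) => l; have [q ->] := bP (w ^+ l).
under eq_bigr do rewrite iter_comb mulr_sumr.
rewrite exchange_big big1 // => i _ /=.
have := congr1 (fun M : 'rV_n => M 0 i) cP; rewrite !mxE => e.
transitivity ((q i)%:A * (\sum_(k < n) c 0 k * iter k s b`_i)).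
  by rewrite mulr_sumr; apply: eq_bigr => j _; rewrite mulrCA.
rewrite (_ : \sum_(k < n) _ = 0) ?mulr0 // -[RHS]e.
by apply: eq_bigr => j _; rewrite !mxE.
Qed.

Lemma conj_mx_powers w : s w <> w ->
  \det (conj_mx [tuple w ^+ i | i < n]) != 0.
Proof.
move=> sw; rewrite -det_tr; apply/negP => /det0P[c c0 cP].
move/negP: c0; apply; apply/eqP/rowP => k; rewrite mxE.
apply: (power_conj_independent dimK sw) => i.
have := congr1 (fun M : 'rV_n => M 0 i) cP; rewrite !mxE => e; rewrite -[RHS]e.
by apply: eq_bigr => j _; rewrite !mxE -tnth_nth tnth_mktuple.
Qed.

Lemma vbasis_span x : x = \sum_(i < n) coord (vbasis {:K}) i x *: (vbasis {:K})`_i.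
Proof. by apply: coord_vbasis; exact: memvf. Qed.

(** The matrix of conjugates of a basis diagonalises multiplication by [x], with the conjugates of
    [x] as eigenvalues. *)
Lemma field_traceE x : (field_trace x)%:A = ctrace s x.
Proof.
pose b := vbasis {:K}; pose P := conj_mx b.
have Pu : P \in unitmx.
  by rewrite unitmxE unitfE conj_mx_basis // => y; exists (fun i => coord b i y); exact: vbasis_span.
pose M := \matrix_(i < n, j < n) (coord b j (x * b`_i))%:A : 'M[K]_n.
pose D := diag_mx (\row_(k < n) iter k s x) : 'M[K]_n.
have MP : M *m P = P *m D.
  apply/matrixP => i k; rewrite mul_mx_diag !mxE.
  rewrite -[RHS]mulrC -iterM [X in iter k s X](vbasis_span (x * b`_i)) iter_comb.
  by apply: eq_bigr => j _; rewrite !mxE.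
have : \tr M = \tr D.
  have -> : M = P *m D *m invmx P by rewrite -MP mulmxK.
  by rewrite mxtrace_mulC mulmxA mulVmx // mul1mx.
rewrite mxtrace_diag => e; rewrite -sum_iter.
have -> : (field_trace x)%:A = \tr M :> K.
  by rewrite /field_trace scaler_suml; apply: eq_bigr => i _; rewrite mxE.
by rewrite e; apply: eq_bigr => i _; rewrite mxE.
Qed.

Lemma det_trace_mx (b : seq K) :
  (\det (\matrix_(i < n, j < n) field_trace (b`_i * b`_j)))%:A = \det (conj_mx b) ^+ 2.
Proof.
rewrite -[LHS]/(in_alg K _) -det_map_mx expr2 -[X in _ * X]det_tr -det_mulmx conj_mx_gram.
by congr (\det _); apply/matrixP => i j; rewrite !mxE /= field_traceE.
Qed.

Lemma det_conj_mx_free (b : n.-tuple K) : \det (conj_mx b) != 0 -> free b.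
Proof.
move=> detP; apply/freeP => k kE i.
have Pu : conj_mx b \in unitmx by rewrite unitmxE unitfE.
pose r : 'rV[K]_n := \row_j (k j)%:A.
have /(congr1 (mulmx^~ (invmx (conj_mx b)))) : r *m conj_mx b = 0.
  apply/rowP => j; rewrite !mxE.
  have [f fE] := iter_rmorph j; have := congr1 f kE; rewrite rmorph0 fE iter_comb => e.
  rewrite -[RHS]e.
  by apply: eq_bigr => l _; rewrite !mxE.
rewrite mulmxK // mul0mx => /rowP/(_ i); rewrite !mxE => /eqP.
by rewrite scaler_eq0 oner_eq0 orbF => /eqP.
Qed.

Lemma free_span_full (b : n.-tuple K) : free b ->
  forall x, exists q : 'I_n -> rat, x = \sum_i q i *: b`_i.
Proof.
move=> fb x; exists (fun i => coord b i x); apply: coord_basis (memvf x).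
by rewrite basisEfree fb subvf size_tuple /=.
Qed.

Lemma conj_mx_replace (b : n.-tuple K) (i : 'I_n) (q : 'I_n -> rat) (b' : n.-tuple K) :
  (forall j : 'I_n, b'`_j = if j == i then \sum_k q k *: b`_k else b`_j) ->
  \det (conj_mx b') = (q i)%:A * \det (conj_mx b).
Proof.
move=> b'E; rewrite (expand_det_row _ i).
have cof j : cofactor (conj_mx b') i j = cofactor (conj_mx b) i j.
  rewrite /cofactor; congr (_ * \det _); apply/matrixP => k l; rewrite !mxE b'E.
  by have := neq_lift i k; rewrite eq_sym => /negbTE ->.
transitivity (\sum_(k < n) (q k)%:A * \sum_(j < n) conj_mx b k j * cofactor (conj_mx b) i j).
  under [RHS]eq_bigr do rewrite mulr_sumr.
  rewrite exchange_big; apply: eq_bigr => j _ /=; rewrite cof mxE b'E eqxx iter_comb mulr_suml.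
  by apply: eq_bigr => k _; rewrite mxE -!mulrA.
have E k : \sum_(j < n) conj_mx b k j * cofactor (conj_mx b) i j = \det (conj_mx b) *+ (k == i).
  have := congr1 (fun M : 'M_n => M k i) (mul_mx_adj (conj_mx b)); rewrite !mxE => <-.
  by apply: eq_bigr => j _; rewrite !mxE.
under eq_bigr do rewrite E.
by rewrite (bigD1 i) //= eqxx big1 ?addr0 // => k /negbTE ->; rewrite mulr0.
Qed.

Lemma det_trace_int (b : seq K) : (forall i : 'I_n, Oint b`_i) ->
  exists z : int, \det (\matrix_(i < n, j < n) field_trace (b`_i * b`_j)) = z%:~R.
Proof.
move=> bO.
have tP i j : exists z : int, field_trace (b`_(i : 'I_n) * b`_(j : 'I_n)) = z%:~R.
  apply: (@Oint_rat K); rewrite field_traceE.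
  have [z ->] := ctrace_int s3 s_fix (OintM (bO i) (bO j)); exact: Oint_int.
pose M := \matrix_(i < n, j < n) sval (cid (tP i j)).
exists (\det M); rewrite -[RHS]/(intr _) -det_map_mx; congr (\det _).
by apply/matrixP => i j; rewrite !mxE; exact: svalP (cid (tP i j)).
Qed.

Variables (R : realType) (v : {rmorphism K -> R}).

(** The discriminant is the square of a nonzero determinant, and [v] makes that determinant real. *)
Lemma det_trace_gt0 (b : seq K) (z : int) : \det (conj_mx b) != 0 ->
  \det (\matrix_(i < n, j < n) field_trace (b`_i * b`_j)) = z%:~R -> 0 < z.
Proof.
move=> detP zE; have := det_trace_mx b; rewrite zE => /(congr1 v).
rewrite -[_%:A]/(in_alg K _) !rmorph_int rmorphXn => e.
by rewrite -(ltr0z R) e exprn_even_gt0 // fmorph_eq0.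
Qed.

(* Descent on the discriminant: an integer with a fractional coordinate [r] on [b]
   replaces a vector of [b] and multiplies the discriminant by [r^2 < 1]. *)
Lemma integral_basis_exists (b : n.-tuple K) :
  (forall i : 'I_n, Oint b`_i) -> \det (conj_mx b) != 0 ->
  exists w : n.-tuple K, integral_basis w.
Proof.
move=> bO bd; have [z zE] := det_trace_int bO.
have [N] := ubnP `|z|%N; elim: N => // N IHN in b bO bd z zE *; rewrite ltnS => zN.
have z0 := det_trace_gt0 bd zE.
have [int_b|] := EM (forall x, Oint x -> exists c : 'I_n -> int, x = \sum_(i < n) b`_i *~ c i).
  exists b; split; first exact: det_conj_mx_free.
  move=> x; split=> [/int_b//|[c ->]]; apply: Oint_sum => i; exact: OintMz.
move=> /existsNP[x] /not_implyP[xO nx].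
have [q xE] := free_span_full (det_conj_mx_free bd) x.
pose r i := q i - (Num.floor (q i))%:~R.
have x'E : x - \sum_(i < n) b`_i *~ Num.floor (q i) = \sum_i r i *: b`_i.
  rewrite {1}xE -sumrB; apply: eq_bigr => i _.
  by rewrite scalerBl scaler_int.
have [i ri] : exists i, r i != 0.
  apply: contrapT => no; apply: nx; exists (fun i => Num.floor (q i)).
  apply/eqP; rewrite -subr_eq0 x'E big1 // => i _.
  have [->|ri] := eqVneq (r i) 0; first by rewrite scale0r.
  by case: no; exists i.
have r0 : 0 <= r i by rewrite subr_ge0 floor_le_tmp.
have r1 : r i < 1 by have := lt_succ_floor (q i); rewrite /r intrD; lra.
pose b' := [tuple (if j == i then \sum_i r i *: b`_i else b`_j) | j < n].
have b'E (j : 'I_n) : b'`_j = if j == i then \sum_i r i *: b`_i else b`_j.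
  by rewrite -tnth_nth tnth_mktuple.
have dE := conj_mx_replace b'E.
have b'O (j : 'I_n) : Oint b'`_j.
  rewrite b'E; case: ifP => _ //; rewrite -x'E; apply: OintB => //.
  by apply: Oint_sum => k; exact: OintMz.
have bd' : \det (conj_mx b') != 0.
  by rewrite dE mulf_neq0 // scaler_eq0 oner_eq0 orbF.
have [z' zE'] := det_trace_int b'O; apply: (IHN b' b'O bd' z' zE').
apply: leq_trans zN; have z0' := det_trace_gt0 bd' zE'.
have : z' < z; last by lia.
rewrite -(ltr_int rat); have : z'%:~R = r i ^+ 2 * z%:~R.
  apply: (fmorph_inj (in_alg K)); rewrite -zE -zE' rmorphM /= det_trace_mx dE exprMn.
  by rewrite -det_trace_mx -[(_ ^+ 2)%:A]/(in_alg K _) rmorphXn.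
move=> ->; rewrite -[ltRHS]mul1r ltr_pM2r ?ltr0z //.
by rewrite expr_lt1.
Qed.

(** The trace form degenerates modulo [p]: the coordinate row of [y] times the Gram matrix vanishes
    modulo [p]. Multiplying by the adjugate shows that [p] divides each coordinate times [d], and
    some coordinate is prime to [p] since [y / p] is not integral. *)
Lemma dvdz_discriminant (p : nat) (w : n.-tuple K) (d : int) (y : K) :
  prime p -> integral_basis w ->
  d%:~R = \det (\matrix_(i < n, j < n) field_trace (w`_i * w`_j)) ->
  Oint y -> ~ Oint (y / p%:R) ->
  (forall x, Oint x -> exists z : int, ctrace s (y * x) = (p%:Z * z)%:~R) ->
  (p%:Z %| d)%Z.
Proof.
move=> p_pr [fw wP] dE yO npy yp.
have wO (i : 'I_n) : Oint w`_i.
  apply/wP; exists (fun j => (j == i)%:Z).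
  by rewrite (bigD1 i) //= eqxx big1 ?addr0 // => j /negbTE ->.
have [c yE] := (wP y).1 yO.
have p0 : (p%:R : K) != 0.
  rewrite -[p%:R]/(p%:Z%:~R) -(rmorph_int (in_alg K)) fmorph_eq0 intr_eq0.
  by case: (p) p_pr.
have [i ci] : exists i, ~~ (p%:Z %| c i)%Z.
  apply: contrapT => no; apply: npy; apply/wP.
  have pc i : (p%:Z %| c i)%Z by apply: contrapT => /negP h; apply: no; exists i.
  exists (fun i => (c i %/ p%:Z)%Z); rewrite yE mulr_suml; apply: eq_bigr => i _.
  by rewrite -{1}(divzK (pc i)) mulrzA -mulrzr -[p%:Z%:~R]/(p%:R) mulfK.
have tP k l : exists z : int, field_trace (w`_(k : 'I_n) * w`_(l : 'I_n)) = z%:~R.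
  apply: (@Oint_rat K); rewrite field_traceE.
  have [z ->] := ctrace_int s3 s_fix (OintM (wO k) (wO l)); exact: Oint_int.
pose M := \matrix_(i < n, j < n) sval (cid (tP i j)) : 'M[int]_n.
have ME : map_mx intr M = \matrix_(i < n, j < n) field_trace (w`_i * w`_j).
  by apply/matrixP => k l; rewrite !mxE; rewrite -(svalP (cid (tP k l))).
have dM : d = \det M by apply: (@intr_inj rat); rewrite dE -ME det_map_mx.
pose r : 'rV[int]_n := \row_j c j.
have rM j : (p%:Z %| ((r *m M) ord0 j)%R)%Z.
  have [z zE] := yp _ (wO j); apply/dvdzP; exists z; apply: (@intr_inj_K K).
  rewrite mulrC -zE yE mulr_suml.
  under [X in ctrace s X]eq_bigr do rewrite mulrzAl.
  rewrite ctrace_comb mxE rmorph_sum /=; apply: eq_bigr => k _.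
  rewrite !mxE rmorphM /= -field_traceE; case: (cid (tP k j)) => z' /= ->.
  by rewrite -[_%:A]/(in_alg K _) rmorph_int mulrzl.
have : (p%:Z %| ((r *m M *m \adj M) ord0 i)%R)%Z.
  by rewrite mxE; apply: rpred_sum => j _; exact: dvdz_mulr.
rewrite -mulmxA mul_mx_adj mul_mx_scalar !mxE -dM.
by rewrite Gauss_dvdzl // coprimezE prime_coprime.
Qed.

End Discriminant.

(** * Construction of the fields *)

Lemma cyclic_cubic_generator (K : splittingFieldType rat) : cyclic_cubic K ->
  exists s : {rmorphism K -> K}, (forall x, s (s (s x)) = x) /\
    (forall x, s x = x -> exists q : rat, x = q%:A).
Proof.
move=> [galK dimK]; pose G := 'Gal({:K} / 1)%G.
have cardG : #|G| = 3%N by rewrite -galois_dim // dimv1 divn1 dimK.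
have /cyclicP[g Gg] : cyclic G by apply: prime_cyclic; rewrite cardG.
have g3 : (g ^+ 3 = 1)%g by rewrite -cardG Gg expg_order.
have galX i x : (g ^+ i)%g x = iter i g x.
  elim: i => [|i IHi]; first by rewrite expg0 gal_id.
  by rewrite expgSr galM ?memvf // IHi.
exists (gal_repr g : {rmorphism K -> K}); split=> x /=.
  by rewrite -[RHS](@gal_id _ _ {:K}) -g3 galX.
move=> gx; apply/vlineP; have /galois_fixedField fixG := galK.
suff: x \in (1 : {subfield K})%VS by [].
rewrite -fixG; apply/fixedFieldP; first exact: memvf.
move=> h; rewrite -[h \in _]/(h \in G) Gg => /cycleP[i ->]; rewrite galX.
by elim: i => //= i ->.
Qed.

(** Building the field as the subfield of [R] generated by a real root provides the embedding at
    once. *)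
Lemma irredp_embedding (R : realType) (p : {poly rat}) (r : R) :
  irreducible_poly p -> root (map_poly ratr p) r ->
  exists (L : fieldExtType rat) (v : {rmorphism L -> R}) (z : L),
    [/\ \dim {:L} = (size p).-1, root (map_poly (in_alg L) p) z
      & <<1; z>>%VS = fullv].
Proof.
move=> irr_p pr; pose iota : {rmorphism rat -> R} := ratr.
have nz_p := irredp_neq0 irr_p.
pose L := SubFieldExtType (iota := iota) pr irr_p.
exists L, (subfx_inj : {rmorphism L -> R}), (subfx_root iota r p : L).
split.
- by rewrite dimvf.
- rewrite -(fmorph_root (subfx_inj : {rmorphism L -> R})) /=.
  rewrite subfx_inj_root // -map_poly_comp.
  rewrite (@eq_map_poly _ _ _ iota) // => q /=; exact: subfx_inj_base.
apply/vspaceP => x; rewrite memvf; apply/Fadjoin_polyP.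
have [q xE] := subfxEroot pr nz_p x; exists (map_poly (in_alg L) q) => //.
by apply/polyOverP=> i; rewrite coef_map memvZ ?mem1v.
Qed.

(** * Cubics whose discriminant is a square *)

Definition cubic (F : nzRingType) (a b c : F) : {poly F} :=
  'X^3 - a%:P * 'X^2 + b%:P * 'X - c%:P.

Lemma size_cubic (F : nzRingType) (a b c : F) : size (cubic a b c) = 4%N.
Proof.
rewrite /cubic -!addrA size_polyDl size_polyXn //.
apply: leq_ltn_trans (size_polyD _ _) _; rewrite gtn_max size_polyN; apply/andP; split.
  by rewrite mul_polyC (leq_ltn_trans (size_scale_leq _ _)) // size_polyXn.
apply: leq_ltn_trans (size_polyD _ _) _; rewrite gtn_max size_polyN mul_polyC.
by rewrite (leq_ltn_trans (size_scale_leq _ _)) ?size_polyX // (leq_ltn_trans (size_polyC_leq1 _)).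
Qed.

Lemma horner_cubic (F : comNzRingType) (a b c x : F) :
  (cubic a b c).[x] = x ^+ 3 - a * x ^+ 2 + b * x - c.
Proof. by rewrite /cubic !hornerE. Qed.

Lemma root_cubic (F : comNzRingType) (a b c x : F) :
  root (cubic a b c) x = (x ^+ 3 - a * x ^+ 2 + b * x - c == 0).
Proof. by rewrite rootE horner_cubic. Qed.

Lemma map_cubic (F F' : nzRingType) (f : {rmorphism F -> F'}) a b c :
  map_poly f (cubic a b c) = cubic (f a) (f b) (f c).
Proof.
rewrite /cubic !(rmorphB, rmorphD) !rmorphM /= !map_polyC map_polyX.
by rewrite ?rmorphXn /= ?map_polyX.
Qed.

Definition cubic_disc (F : comNzRingType) (a b c : F) : F :=
  a ^+ 2 * b ^+ 2 - 4 * b ^+ 3 - 4 * a ^+ 3 * c + 18 * a * b * c - 27 * c ^+ 2.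

Lemma rmorph_cubic_disc (F F' : comNzRingType) (f : {rmorphism F -> F'}) a b c :
  f (cubic_disc a b c) = cubic_disc (f a) (f b) (f c).
Proof.
by rewrite /cubic_disc; ring.
Qed.

(** [D] is the derivative at [w], that is (w - w2)(w - w3), and [d] is up to sign the product of all
    root differences. So [d / D] is w2 - w3 up to sign, while w2 + w3 is [a - w]. *)
Lemma cubic_split (F : fieldType) (a b c d w : F) : (2 : F) != 0 -> d != 0 ->
  w ^+ 3 - a * w ^+ 2 + b * w - c = 0 ->
  d ^+ 2 = cubic_disc a b c ->
  exists w2 w3, cubic a b c = ('X - w%:P) * ('X - w2%:P) * ('X - w3%:P).
Proof.
move=> two0 d0 wE dE.
pose D := 3 * w ^+ 2 - 2 * a * w + b.
have cE : c = w ^+ 3 - a * w ^+ 2 + b * w by apply/eqP; rewrite eq_sym -subr_eq0 wE.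
have dE' : d ^+ 2 = D ^+ 2 * ((a - w) ^+ 2 - 4 * (w ^+ 2 - a * w + b)).
  by rewrite dE /cubic_disc cE /D; ring.
have D0 : D != 0.
  by apply: contraNneq d0 => D0; rewrite -sqrf_eq0 dE' D0 expr0n mul0r.
have four0 : (4 : F) != 0.
  by have -> : (4 : F) = 2 * 2 by [ring]; rewrite mulf_neq0.
exists ((a - w + d / D) / 2), ((a - w - d / D) / 2).
set w2 := _ / 2; set w3 := _ / 2.
have s23 : w2 + w3 = a - w by rewrite /w2 /w3; field; rewrite D0 two0.
have p23 : w2 * w3 = w ^+ 2 - a * w + b.
  have -> : w2 * w3 = ((a - w) ^+ 2 - d ^+ 2 / D ^+ 2) / 2 ^+ 2.
    by rewrite /w2 /w3; field; rewrite four0 D0 two0.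
  by rewrite dE' [D ^+ 2 * _]mulrC mulfK ?expf_neq0 //; field.
clearbody w2 w3.
have -> : a = w + (w2 + w3) by rewrite s23; ring.
have -> : b = w * (w2 + w3) + w2 * w3 by rewrite s23 p23; ring.
have -> : c = w * (w2 * w3) by rewrite p23 cE; ring.
by rewrite /cubic; ring.
Qed.

Lemma cyclic_cubic_exists (R : realType) (a b c d : rat) :
  (forall q : rat, q ^+ 3 - a * q ^+ 2 + b * q - c != 0) -> d != 0 ->
  d ^+ 2 = cubic_disc a b c ->
  1 <= a -> 0 <= b -> 0 <= c ->
  exists (K : splittingFieldType rat) (v : {rmorphism K -> R}) (w : K),
    cyclic_cubic K /\ w ^+ 3 - a%:A * w ^+ 2 + b%:A * w - c%:A = 0.
Proof.
move=> noroot d0 dE a1 b0 c0.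
have irr : irreducible_poly (cubic a b c).
  by apply: cubic_irreducible; [rewrite size_cubic | move=> q; rewrite root_cubic].
(* The cubic is [- c <= 0] at 0 and nonnegative at [a + c], because [a + c >= 1]. *)
have [r _ rP] : exists2 r : R, 0 <= r <= ratr (a + c) & root (map_poly ratr (cubic a b c)) r.
  apply: poly_ivt; first by rewrite ler0q; lra.
  rewrite -[0 as X in _.[X]](ratr_nat R 0) !horner_map /= !horner_cubic.
  rewrite lerq0 ler0q; apply/andP; split.
    by rewrite !expr0n /= !mulr0 subrr !add0r oppr_le0.
  have -> : (a + c) ^+ 3 - a * (a + c) ^+ 2 + b * (a + c) - c =
    c * ((a + c) ^+ 2 - 1) + b * (a + c) by ring.
  by rewrite addr_ge0 ?mulr_ge0 ?subr_ge0 ?exprn_ege1 //; lra.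
have [L [v [z [dimL pz genL]]]] := irredp_embedding irr rP.
rewrite size_cubic /= in dimL; rewrite map_cubic root_cubic in pz.
have two0 : (2 : L) != 0 by rewrite -(rmorph_nat (in_alg L)) fmorph_eq0.
have [||w2 [w3 splitP]] := @cubic_split L a%:A b%:A c%:A d%:A z two0 _ (eqP pz).
- by rewrite -[_%:A]/(in_alg L d) fmorph_eq0.
- by have := congr1 (in_alg L) dE; rewrite rmorph_cubic_disc rmorphXn.
have splitL : splitting_field_axiom L.
  exists (map_poly (in_alg L) (cubic a b c)).
    by apply/polyOverP => i; rewrite coef_map memvZ ?mem1v.
  exists [:: z; w2; w3]; first by rewrite map_cubic !big_cons big_nil mulr1 mulrA splitP eqpxx.
  by apply/eqP; rewrite eqEsubv subvf /= -genL adjoin_cons subv_adjoin_seq.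
pose K : splittingFieldType rat := HB.pack L (FieldExt_isSplittingField.Build rat L splitL).
exists K, v, z; split; last exact: eqP pz.
split; last exact: dimL.
apply/and3P; split; [exact: subvf | | exact: normalFieldf].
by apply/separableP => x _; apply: pcharf0_separable => l; rewrite pchar_lalg pchar_num.
Qed.

(** For a root a / b in lowest terms, a^3 is [m] times a factor congruent to b^3 modulo a. As [p]
    divides a and not b, that factor is prime to [p], so the exponent of [p] in [m] would be three
    times that in a. *)
Lemma no_rational_root (m p : nat) (q : rat) : prime p -> ~~ (3 %| logn p m)%N ->
  q ^+ 3 - (2 * m%:R) * q ^+ 2 + (5 * m%:R) * q - m%:R != 0.
Proof.
move=> p_pr pm; apply/eqP => qE.
have m0 : (0 < m)%N by case: (m) pm => //; rewrite logn0.
pose a := numq q; pose b := denq q.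
have b0 : b != 0 by exact: denq_neq0.
have qab : q = a%:~R / b%:~R by rewrite divq_num_den.
have cop : coprime `|a| `|b| by exact: coprime_num_den.
have E : a ^+ 3 = m%:Z * (b * (2 * a ^+ 2 - 5 * (a * b) + b ^+ 2)).
  apply: (@intr_inj rat); apply/eqP; rewrite -subr_eq0; apply/eqP.
  have bQ : (b%:~R : rat) != 0 by rewrite intr_eq0.
  transitivity ((q ^+ 3 - 2 * m%:R * q ^+ 2 + 5 * m%:R * q - m%:R) * b%:~R ^+ 3); last by rewrite qE mul0r.
  by rewrite qab; field.
have pm' : (p %| m)%N.
  have : (0 < logn p m)%N by case: (logn p m) pm.
  by rewrite logn_gt0 mem_primes => /and3P[].
have pa : (p%:Z %| a)%Z.
  have : (p%:Z %| (a ^+ 3)%R)%Z by rewrite E dvdz_mulr // dvdzE.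
  by rewrite !dvdzE abszX Euclid_dvdX // => /andP[].
have npb : ~~ (p%:Z %| b)%Z.
  apply/negP => pb; have : (p %| gcdn `|a| `|b|)%N by rewrite dvdn_gcd; apply/andP; split.
  by rewrite (eqP cop) dvdn1 => /eqP p1; rewrite p1 in p_pr.
have npt : ~~ (p%:Z %| (b * (2 * a ^+ 2 - 5 * (a * b) + b ^+ 2))%R)%Z.
  rewrite dvdzE abszM Euclid_dvdM // -!dvdzE negb_or npb /=.
  apply: contra npb => h; have : (p%:Z %| (b ^+ 2)%R)%Z.
    have -> : b ^+ 2 = (2 * a ^+ 2 - 5 * (a * b) + b ^+ 2) + (5 * b - 2 * a) * a by ring.
    by apply: rpredD => //; exact: dvdz_mull.
  by rewrite !dvdzE abszX Euclid_dvdX // => /andP[].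
have t0 : (0 < `|(b * (2 * a ^+ 2 - 5 * (a * b) + b ^+ 2))%R|)%N.
  by rewrite absz_gt0; apply: contraNneq npt => ->; exact: dvdz0.
have /(congr1 (fun x => logn p `|x|%N)) := E.
have l0 : logn p `|(b * (2 * a ^+ 2 - 5 * (a * b) + b ^+ 2))%R| = 0%N.
  by apply/eqP; rewrite -leqn0 leqNgt logn_gt0 mem_primes p_pr t0; move: npt; rewrite dvdzE.
rewrite abszX lognX abszM lognM // l0 addn0 /=.
by move=> e; move: pm; rewrite -e dvdn_mulr.
Qed.

(* [S], [T] and [m^2] are the symmetric functions of a square root of [m w]. *)
Lemma not_square_mod11 (m : nat) (S T : int) : (m = 4 %[mod 11])%N ->
  S ^+ 2 - 2 * T = 2 * m%:Z ^+ 2 -> T ^+ 2 - 2 * m%:Z ^+ 2 * S <> 5 * m%:Z ^+ 3.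
Proof.
move=> m4 e1 e2.
have mE : m%:Z = (m %/ 11)%N%:Z * 11 + 4 by rewrite {1}(divn_eq m 11) m4 PoszD PoszM.
move: (m %/ 11)%N%:Z mE e1 e2 => j -> {m m4}.
have [S1 [x [xlt ->]]] : exists (S1 : int) (x : nat), (x < 11)%N /\ S = S1 * 11 + x%:Z.
  exists (S %/ 11)%Z, `|(S %% 11)%Z|%N; rewrite {3}(divz_eq S 11).
  have := modz_ge0 S (isT : 11 != 0 :> int); have := ltz_pmod S (isT : 0 < 11 :> int).
  by split; lia.
have [T1 [y [ylt ->]]] : exists (T1 : int) (y : nat), (y < 11)%N /\ T = T1 * 11 + y%:Z.
  exists (T %/ 11)%Z, `|(T %% 11)%Z|%N; rewrite {3}(divz_eq T 11).
  have := modz_ge0 T (isT : 11 != 0 :> int); have := ltz_pmod T (isT : 0 < 11 :> int).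
  by split; lia.
move=> e1 e2.
(* With [m] replaced by its residue 4, the right-hand sides become 32 = 2 * 4^2 and 320 = 5 * 4^3;
   the 121 pairs of residues are then checked by computation. *)
have d1 : (11 %| (x%:Z ^+ 2 - 2 * y%:Z - 32)%R)%Z.
  apply/dvdzP; exists (2 * (j ^+ 2 * 11 + 8 * j) - S1 ^+ 2 * 11 - 2 * S1 * x%:Z + 2 * T1).
  by move: e1 => /eqP; rewrite -subr_eq0 => /eqP e; apply/eqP; rewrite -subr_eq0 -[X in _ == X]e; apply/eqP; ring.
have d2 : (11 %| (y%:Z ^+ 2 - 32 * x%:Z - 320)%R)%Z.
  apply/dvdzP; exists (5 * (j ^+ 3 * 121 + 132 * j ^+ 2 + 48 * j) - T1 ^+ 2 * 11 - 2 * T1 * y%:Z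
    + 2 * (j ^+ 2 * 11 + 8 * j) * (S1 * 11 + x%:Z) + 32 * S1).
  by move: e2 => /eqP; rewrite -subr_eq0 => /eqP e; apply/eqP; rewrite -subr_eq0 -[X in _ == X]e; apply/eqP; ring.
have : all (fun x : nat => all (fun y : nat => ~~ ((11 %| (x%:Z ^+ 2 - 2 * y%:Z - 32)%R)%Z && (11 %| (y%:Z ^+ 2 - 32 * x%:Z - 320)%R)%Z)) (iota 0 11)) (iota 0 11).
  by vm_compute.
by move=> /allP/(_ x); rewrite mem_iota => /(_ xlt)/allP/(_ y); rewrite mem_iota => /(_ ylt); rewrite d1 d2.
Qed.

Lemma cubic_roots_sym (F : fieldType) (a b c x y z : F) :
  x != y -> y != z -> x != z ->
  x ^+ 3 - a * x ^+ 2 + b * x - c = 0 -> y ^+ 3 - a * y ^+ 2 + b * y - c = 0 ->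
  z ^+ 3 - a * z ^+ 2 + b * z - c = 0 ->
  [/\ x + y + z = a, x * y + y * z + z * x = b & x * y * z = c].
Proof.
move=> xy yz xz ex ey ez.
have h (t : F) : x != t -> t ^+ 3 - a * t ^+ 2 + b * t - c = 0 ->
    x ^+ 2 + x * t + t ^+ 2 - a * (x + t) + b = 0.
  move=> xt et; apply/eqP; have : (x - t) * (x ^+ 2 + x * t + t ^+ 2 - a * (x + t) + b) == 0.
    apply/eqP; transitivity ((x ^+ 3 - a * x ^+ 2 + b * x - c) - (t ^+ 3 - a * t ^+ 2 + b * t - c)); first by ring.
    by rewrite ex et subrr.
  by rewrite mulf_eq0 [x - t == 0]subr_eq0 (negbTE xt).
have hy := h y xy ey; have hz := h z xz ez.
have aE : x + y + z = a.
  apply/eqP; rewrite -subr_eq0; have : (y - z) * (x + y + z - a) == 0.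
    apply/eqP; transitivity ((x ^+ 2 + x * y + y ^+ 2 - a * (x + y) + b) - (x ^+ 2 + x * z + z ^+ 2 - a * (x + z) + b)); first by ring.
    by rewrite hy hz subrr.
  by rewrite mulf_eq0 [y - z == 0]subr_eq0 (negbTE yz).
have bE : x * y + y * z + z * x = b.
  apply/eqP; rewrite -subr_eq0 -oppr_eq0; apply/eqP; rewrite -[RHS]hy -aE; ring.
split=> //; apply/eqP; rewrite -subr_eq0; apply/eqP; rewrite -[RHS]ex -aE -bE; ring.
Qed.

(** * The totally positive unit and the discriminant of one field of the family *)

Section FamilyField.
Variables (R : realType) (K : fieldExtType rat) (s : {rmorphism K -> K}) (v : {rmorphism K -> R}).
Hypothesis s3 : forall x, s (s (s x)) = x.
Hypothesis s_fix : forall x, s x = x -> exists q : rat, x = q%:A.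
Variables (m : nat) (w : K).
Hypothesis m_gt0 : (0 < m)%N.
Hypothesis w_root : w ^+ 3 - 2 * m%:R * w ^+ 2 + 5 * m%:R * w - m%:R = 0.
Hypothesis w_moved : s w <> w.
Local Notation Oint := (@ring_of_integers K).
Local Notation Ounit := (@integer_unit K).

Lemma natr_neq0 (k : nat) : (0 < k)%N -> (k%:R : K) != 0.
Proof.
move=> k0; rewrite -[k%:R]/(k%:Z%:~R) -(rmorph_int (in_alg K)) fmorph_eq0 intr_eq0.
by rewrite -lt0n.
Qed.

Let m0 : (m%:R : K) != 0. Proof. exact: natr_neq0. Qed.

Lemma root_rmorph x : x ^+ 3 - 2 * m%:R * x ^+ 2 + 5 * m%:R * x - m%:R = 0 ->
  s x ^+ 3 - 2 * m%:R * s x ^+ 2 + 5 * m%:R * s x - m%:R = 0.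
Proof. by move=> /(congr1 s); rewrite rmorph0 => <-; ring. Qed.

Let sw_root := root_rmorph w_root.
Let ssw_root := root_rmorph sw_root.

Lemma root_gt0 x : x ^+ 3 - 2 * m%:R * x ^+ 2 + 5 * m%:R * x - m%:R = 0 -> 0 < v x.
Proof.
move=> /(congr1 v); rewrite rmorph0 => e; rewrite ltNge; apply/negP => vx.
have e' : v x ^+ 3 - 2 * m%:R * v x ^+ 2 + 5 * m%:R * v x - m%:R = 0.
  by rewrite -[RHS]e; ring.
have mR : 0 < (m%:R : R) by rewrite ltr0n.
have : v x ^+ 3 <= 0 by rewrite exprSr mulr_ge0_le0 // sqr_ge0.
have : 0 <= m%:R * v x ^+ 2 by rewrite mulr_ge0 ?sqr_ge0 // ltW.
have : m%:R * v x <= 0 by rewrite mulr_ge0_le0 // ltW.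
by move: e'; rewrite -!mulrA; lra.
Qed.

Lemma w_sym : [/\ ctrace s w = 2 * m%:R, csym2 s w = 5 * m%:R & cnorm s w = m%:R].
Proof.
have n01 : w != s w by apply/eqP => /esym.
have n12 : s w != s (s w) by rewrite (inj_eq (fmorph_inj s)).
have n02 : w != s (s w) by rewrite eq_sym -[X in _ == X]s3 !(inj_eq (fmorph_inj s)).
exact: cubic_roots_sym.
Qed.

Let xi := 2 * w ^+ 2 - 5 * w + 1.

Lemma w_cube : w ^+ 3 = m%:R * xi.
Proof. by apply/eqP; rewrite -subr_eq0 -[X in _ == X]w_root /xi; apply/eqP; ring. Qed.

Lemma w_Oint : Oint w.
Proof.
exists (cubic (2 * m%:Z) (5 * m%:Z) m%:Z).
  by rewrite monicE lead_coefE size_cubic /cubic !(coefB, coefD, coefCM, coefXn, coefX, coefC) /= ?mulr0 ?subr0 ?addr0.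
by rewrite map_cubic root_cubic -w_root; apply/eqP; ring.
Qed.

Lemma w_neq0 : w != 0.
Proof.
by apply/eqP => w0; have := root_gt0 w_root; rewrite w0 rmorph0 ltxx.
Qed.

Let w0 := w_neq0.
Let sw0 : s w != 0. Proof. by rewrite fmorph_eq0. Qed.

Lemma xi_Oint : Oint xi.
Proof.
apply: OintD (Oint_int K 1); apply: OintB; apply: OintM; try exact: (Oint_int K 2); try exact: (Oint_int K 5); [apply: OintX|]; exact: w_Oint.
Qed.

Lemma xi_norm : cnorm s xi = 1.
Proof.
have [_ _ N] := w_sym.
have := congr1 (cnorm s) w_cube; rewrite cnormM {1}/cnorm.
have -> : w ^+ 3 * s (w ^+ 3) * s (s (w ^+ 3)) = cnorm s w ^+ 3 by rewrite /cnorm; ring.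
have -> : cnorm s m%:R = m%:R ^+ 3 by rewrite /cnorm; ring.
rewrite N => e; apply: (mulfI (expf_neq0 3 m0)); by rewrite -e mulr1.
Qed.

Lemma xi_unit : Ounit xi.
Proof.
have xi0 : xi != 0.
  by apply/eqP => xi0; have /eqP := w_cube; rewrite xi0 mulr0 expf_eq0 /= (negbTE w0).
split=> //; first exact: xi_Oint.
have -> : xi^-1 = s xi * s (s xi).
  by apply: (mulfI xi0); rewrite divff // mulrA -[LHS]xi_norm.
by apply: OintM; do ?apply: Oint_rmorph; exact: xi_Oint.
Qed.

Definition ratio := w / s w.

(** The cube of [ratio] is the unit [xi / s xi], so [ratio] and its inverse are integral as cube
    roots of integral elements. *)
Lemma ratio_unit : Ounit ratio.
Proof.
have ratio3 : ratio ^+ 3 = xi / s xi.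
  have E : s w ^+ 3 = m%:R * s xi by rewrite -rmorphXn w_cube rmorphM rmorph_nat.
  by rewrite /ratio expr_div_n w_cube E -mulf_div divff // mul1r.
have xU := xi_unit; have sxU := Ounit_rmorph s xU.
have [_ u1 u2] := OunitM xU (OunitV sxU).
split; first by rewrite mulf_neq0 ?invr_eq0.
  by apply: (@Oint_unexp _ _ 3) => //; rewrite ratio3.
by apply: (@Oint_unexp _ _ 3) => //; rewrite exprVn ratio3.
Qed.

Lemma ratio_gt0 : [/\ 0 < v ratio, 0 < v (s ratio) & 0 < v (s (s ratio))].
Proof.
have p0 := root_gt0 w_root; have p1 := root_gt0 sw_root; have p2 := root_gt0 ssw_root.
by split; rewrite /ratio !rmorphM !fmorphV ?s3 divr_gt0.
Qed.

(** If [ratio] is a square, so is [w * s w], hence so is its conjugate [s w * s (s w)]. Multiplying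
    by w^2 and using that w has norm [m] makes [m * w] a square, and the symmetric functions of its
    root contradict [not_square_mod11]. *)
Lemma ratio_not_square : (m = 4 %[mod 11])%N -> forall q, ratio <> q ^+ 2.
Proof.
move=> m4 q qE; have [tw ew nw] := w_sym.
have wsw : w * s w = (q * s w) ^+ 2.
  by rewrite exprMn -qE /ratio; field.
have [z zE zn] : exists2 z, z ^+ 2 = m%:R * w & cnorm s z = m%:R ^+ 2.
  pose z := w * (s q * s (s w)).
  have zE : z ^+ 2 = m%:R * w.
    have := congr1 s wsw; rewrite rmorphXn !rmorphM => e.
    by rewrite /z exprMn -e -nw /cnorm; ring.
  (* The norm of [z] is only known up to sign; since the degree is odd, passing to [- z] corrects
     it. *)
  have : cnorm s z ^+ 2 = (m%:R ^+ 2) ^+ 2.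
    have -> : cnorm s z ^+ 2 = cnorm s (z ^+ 2) by rewrite /cnorm; ring.
    rewrite zE cnormM nw (_ : cnorm s m%:R = m%:R ^+ 3); last by rewrite /cnorm; ring.
    by ring.
  move=> /eqP; rewrite eqf_sqr => /orP[] /eqP e; first by exists z.
  exists (- z); first by rewrite sqrrN.
  have -> : cnorm s (- z) = - cnorm s z by rewrite /cnorm; ring.
  by rewrite e opprK.
have zO : Oint z.
  by apply: (@Oint_unexp _ _ 2) => //; rewrite zE; exact: OintM (Oint_int K m) w_Oint.
have [S SE] := ctrace_int s3 s_fix zO; have [T TE] := csym2_int s3 s_fix zO.
apply: (@not_square_mod11 m S T m4).
  apply: (@intr_inj_K K).
  transitivity (ctrace s z ^+ 2 - 2 * csym2 s z); first by rewrite SE TE; ring.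
  have -> : ctrace s z ^+ 2 - 2 * csym2 s z = ctrace s (z ^+ 2) by rewrite /ctrace /csym2; ring.
  rewrite zE (_ : ctrace s (m%:R * w) = m%:R * ctrace s w); last by rewrite /ctrace; ring.
  by rewrite tw; ring.
apply: (@intr_inj_K K).
transitivity (csym2 s z ^+ 2 - 2 * cnorm s z * ctrace s z); first by rewrite SE TE zn -[m%:R]/(m%:Z%:~R : K); ring.
have -> : csym2 s z ^+ 2 - 2 * cnorm s z * ctrace s z = csym2 s (z ^+ 2).
  by rewrite /ctrace /csym2 /cnorm; ring.
rewrite zE (_ : csym2 s (m%:R * w) = m%:R ^+ 2 * csym2 s w); last by rewrite /csym2; ring.
by rewrite ew; ring.
Qed.

(** Each conjugate of [y] is an integral multiple of [y], so the trace of [y * x] is [y * k] with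
    [k] integral. Its cube [m1 * xi * k ^+ 3] is divisible by [p], hence so is the trace. *)
Lemma dvdz_ctrace (p m1 : nat) y : (0 < p)%N -> prime p -> (p %| m1)%N ->
  Oint y -> y ^+ 3 = m1%:R * xi -> Oint (s y / y) -> y != 0 ->
  forall x, Oint x -> exists z : int, ctrace s (y * x) = (p%:Z * z)%:~R.
Proof.
move=> p0 p_pr /dvdnP[m2 m1E] yO y3 ry y0 x xO.
have [t tE] := ctrace_int s3 s_fix (OintM yO xO); rewrite tE.
have sry : Oint (s (s y) / y).
  have -> : s (s y) / y = s (s y / y) * (s y / y).
    by rewrite rmorphM fmorphV; field; rewrite ?fmorph_eq0 y0.
  by apply: OintM => //; exact: Oint_rmorph.
pose k := x + (s y / y) * s x + (s (s y) / y) * s (s x).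
have kO : Oint k.
  by do 2?apply: OintD => //; apply: OintM => //; do ?apply: Oint_rmorph.
have yk : t%:~R = y * k by rewrite -tE /ctrace !rmorphM /k; field.
have t3 : (t ^+ 3)%:~R = p%:R * (m2%:R * xi * k ^+ 3) :> K.
  by rewrite rmorphXn /= yk exprMn y3 m1E natrM; ring.
have pK := natr_neq0 p0.
(* This element is both integral and equal to the rational number t^3 / p. *)
have [z zE] : exists z : int, m2%:R * xi * k ^+ 3 = z%:~R.
  apply: (fixed_Oint s_fix).
    apply: (mulfI pK); rewrite -[RHS]t3; transitivity (s (t ^+ 3)%:~R); last by rewrite rmorph_int.
    by rewrite t3 [in RHS]rmorphM rmorph_nat.
  apply: OintM; last exact: OintX.
  by apply: OintM xi_Oint; exact: (Oint_int K m2).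
have : (p%:Z %| t ^+ 3)%Z.
  apply/dvdzP; exists z; apply: (@intr_inj_K K); rewrite t3 zE mulrC.
  by rewrite rmorphM.
rewrite dvdzE abszX Euclid_dvdX // => /andP[pt _].
have /dvdzP[c ->] : (p%:Z %| t)%Z by rewrite dvdzE.
by exists c; rewrite mulrC.
Qed.

Hypothesis dimK : \dim {:K} = 3.

Lemma discriminant_exists (p : nat) : prime p -> ~~ (3 %| logn p m)%N ->
  exists2 d : int, is_discriminant K d & (p%:Z <= d).
Proof.
move=> p_pr np; have p0 := prime_gt0 p_pr; have pK := natr_neq0 p0.
have bd := conj_mx_powers s3 dimK w_moved.
have [|b ib] := integral_basis_exists s3 s_fix dimK v _ bd.
  by move=> i; rewrite -tnth_nth tnth_mktuple; apply: OintX; exact: w_Oint.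
have [fb bP] := ib.
have bO (i : 'I_(\dim {:K})) : Oint b`_i.
  apply/bP; exists (fun j => (j == i)%:Z).
  by rewrite (bigD1 i) //= eqxx big1 ?addr0 // => j /negbTE ->.
have [d dE] := det_trace_int s3 s_fix dimK bO.
exists d; first by exists b.
have bd' : \det (conj_mx s b) != 0.
  by apply: (conj_mx_basis s3 s_fix dimK); exact: free_span_full.
have d0 := det_trace_gt0 s3 s_fix dimK v bd' dE.
set e := logn p m in np; pose g := (e %/ 3)%N.
have pe k : (p ^ k %| m)%N = (k <= e)%N by rewrite pfactor_dvdn.
have eg : (3 * g < e < 3 * g.+1)%N by rewrite /g; lia.
have /dvdnP[m1 mE] : (p ^ (3 * g) %| m)%N by rewrite pe; lia.
have pm1 : (p %| m1)%N.
  have pg : (0 < p ^ (3 * g))%N by rewrite expn_gt0 p0.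
  by rewrite -(dvdn_pmul2r pg) -mE -expnS pe; lia.
have pgK : (p%:R : K) ^+ g != 0 by rewrite expf_neq0.
(* [w^3] is [m] times a unit, so [y^3] is divisible by [p] while [y / p] is not
   integral; hence [p] ramifies. *)
pose y := w / p%:R ^+ g.
have y0 : y != 0 by rewrite mulf_neq0 ?invr_eq0.
have y3 : y ^+ 3 = m1%:R * xi.
  rewrite /y expr_div_n w_cube mE natrM natrX -exprM mulnC.
  by field; rewrite expf_neq0.
have yO : Oint y.
  apply: (@Oint_unexp _ _ 3) => //; rewrite y3.
  by apply: OintM xi_Oint; exact: (Oint_int K m1).
have syE : s y = s w / p%:R ^+ g by rewrite /y rmorphM fmorphV rmorphXn rmorph_nat.
have ryO : Oint (s y / y).
  have [_ _ +] := ratio_unit; congr integralOver.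
  by rewrite syE /ratio /y; field; rewrite w0 sw0 pgK.
(* The norm of [y / p] is m / p^(3 (g + 1)), and 3 (g + 1) exceeds the exponent of [p] in [m]. *)
have nyp : ~ Oint (y / p%:R).
  move=> /(cnorm_int s3 s_fix)[z zE].
  have [_ _ nw] := w_sym.
  have E : m%:R = z%:~R * (p ^ (3 * g.+1))%:R :> K.
    have -> : (p ^ (3 * g.+1) = (p ^ g * p) ^ 3)%N by rewrite -expnSr -expnM mulnC.
    rewrite natrX natrM natrX.
    have sE x : s (x / p%:R ^+ g / p%:R) = s x / p%:R ^+ g / p%:R.
      by rewrite !rmorphM !fmorphV rmorphXn rmorph_nat.
    by rewrite -zE -nw /cnorm /y !sE; field; rewrite pgK pK.
  have : ((p ^ (3 * g.+1))%N%:Z %| m%:Z)%Z.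
    apply/dvdzP; exists z; apply: (@intr_inj_K K); rewrite rmorphM /=.
    exact: E.
  by rewrite dvdzE /= pe => h; case/andP: eg => _; rewrite ltnNge h.
have pd : (p%:Z %| d)%Z.
  apply: (dvdz_discriminant s3 s_fix dimK p_pr ib (esym dE) yO nyp).
  exact: (dvdz_ctrace p0 p_pr pm1).
have /dvdzP[c dc] := pd.
have pz : 0 < p%:Z by [].
by rewrite dc in d0 *; rewrite pmulr_lgt0 // in d0; rewrite -[leLHS]mul1r ler_pM2r //; lia.
Qed.

End FamilyField.

Theorem theoremA2 (R : realType) (N : int) :
  exists K : splittingFieldType rat,
    [/\ cyclic_cubic K,
        exists2 d : int, is_discriminant K d & N < d
      & unit_signature_rank R K = 1%N].
Proof.
have [m [y [p [my m4 p_pr Np np]]]] := exists_conic_point `|N|.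
have m0 : (0 < m)%N by case: (m) np => //; rewrite logn0.
(* By parity: 27 is odd while 68 and 320 are even. *)
have y0 : y != 0.
  by apply/eqP => y0; move: my; rewrite /on_conic y0 expr0n /= !expr2; lia.
have m0Q : (m%:R : rat) != 0 by rewrite pnatr_eq0 -lt0n.
(* For these coefficients the discriminant is m^2 (68 m^2 - 320 m - 27), and the conic equation
   gives it the square root [m * y]. *)
have [||||||K [v [w [cycK wE]]]] :=
    @cyclic_cubic_exists R (2 * m%:R) (5 * m%:R) m%:R (m%:R * y%:~R).
- by move=> q; exact: no_rational_root p_pr np.
- by rewrite mulf_neq0 // intr_eq0.
- have := congr1 (intr : int -> rat) my; rewrite rmorphXn /= => yE.
  by rewrite exprMn yE /cubic_disc; ring.
- by rewrite -natrM ler1n muln_gt0.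
- by rewrite mulr_ge0.
- exact: ler0n.
have [s [s3 s_fix]] := cyclic_cubic_generator cycK.
have w_root : w ^+ 3 - 2 * m%:R * w ^+ 2 + 5 * m%:R * w - m%:R = 0.
  rewrite -[RHS]wE -[(2 * _)%:A]/(in_alg K _) -[(5 * _)%:A]/(in_alg K _).
  by rewrite -[m%:R%:A]/(in_alg K _); ring.
have w_moved : s w <> w.
  move=> /s_fix[q qE]; have /eqP := no_rational_root q p_pr np; apply.
  apply: (fmorph_inj (in_alg K)); rewrite rmorph0 -[RHS]w_root qE -[q%:A]/(in_alg K _).
  by ring.
exists K; split=> //.
  have [d dd pd] := discriminant_exists v s3 s_fix m0 w_root w_moved cycK.2 p_pr np.
  by exists d => //; apply: lt_le_trans pd; lia.
have [u0 u1 u2] := ratio_gt0 v s3 m0 w_root.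
have usq := ratio_not_square v s3 s_fix m0 w_root w_moved m4.
have uU := ratio_unit v s3 m0 w_root w_moved.
apply: (unit_signature_rank1 (v := v)) => x f xU.
exact: (unit_emb_sign s3 s_fix uU u0 u1 u2 usq f xU).
Qed.
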